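(* For every integer $k\ge 0$ there exists a constant $C(k)>0$ depending only on $k$ such that the following holds. Let $d\in\mathbb{N}$ and let $F$ be a symmetric probability distribution on $\mathbb{R}^d$ with $\operatorname{supp}F\subset\mathbb{Z}^d$ and $q:=F\{\vec 0\}\in(0,1)$. Let $D=\exp\big((F-I)-\tfrac12(F-I)^{*2}\big)$ and, for $n\in\mathbb{N}$ with $k<n$, let $$M_k=F^{*n}-\sum_{m=0}^k\binom{n}{m}D^{*(n-m)}*(F-D)^{*m}.$$ Then, for any $n\in\mathbb{N}$ with $k<n$, $$\|M_k\|_{TV}\leq \frac{C(k)\,\delta^{3(k+1)}(nq)}{q^{6k+11/2}\, n^{2(k+1)}} +\frac{C(k)(1-q)^{6(k+1)}}{n^{2(k+1)}\,q^{6k+13/2}}.$$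
   Context: Symmetric means $F\{\vec x\}=F\{-\vec x\}$ for all $\vec x\in\mathbb{Z}^d$. $I$ is the distribution concentrated at $\vec 0\in\mathbb{R}^d$; $*$ is convolution of finite signed measures on $\mathbb{R}^d$; $M^{*j}$ is the $j$-fold convolution power, $M^{*0}=I$; $\exp(M)=\sum_{j\ge 0}M^{*j}/j!$. For finite signed measures supported on $\mathbb{Z}^d$, $\|M\|_{TV}=\sum_{\vec m\in\mathbb{Z}^d}|M\{\vec m\}|$. With $p_{\vec x}=F\{\vec x\}$, for $y>0$, $$\delta(y)=\sum_{\vec x\in \operatorname{supp}F\setminus\{\vec 0\}}\min(1,\,4y\,p_{\vec x}),$$ and $\delta^{j}(y)=(\delta(y))^{j}$. *)

(* Defs.v *)
From HB Require Import structures.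
From mathcomp Require Import all_boot all_order all_algebra.
From mathcomp Require Import all_classical all_reals all_analysis.
From mathcomp Require Import lra.

Set Implicit Arguments.
Unset Strict Implicit.
Unset Printing Implicit Defensive.
Import Order.TTheory GRing.Theory Num.Theory.
Import numFieldNormedType.Exports.
Local Open Scope classical_set_scope.
Local Open Scope ring_scope.

(* The Borel sigma-algebra of the product topology on 'M[R]_(m, n). *)
Section borel_instance.
Context (R : realType) (m n : nat).
Local Notation borel := <<s @open 'M[R]_(m, n) >>.

Let borelC (A : set 'M[R]_(m, n)) : borel A -> borel (~` A).
Proof. by move=> mA; rewrite -setTD; exact: sigma_algebraCD. Qed.

HB.instance Definition _ :=
  @isMeasurable.Build (sigma_display (@open 'M[R]_(m, n))) 'M[R]_(m, n)
    borel (@sigma_algebra0 _ setT _) borelC (@sigma_algebra_bigcup _ setT _).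

End borel_instance.

Section borel_matrix.
Context (R : realType) (m n : nat).
Local Notation M := 'M[R]_(m, n).

Lemma measurable_open_mx (U : set M) : open U -> measurable U.
Proof. by move=> oU; apply: sub_sigma_algebra. Qed.

Lemma measurable_closed_mx (U : set M) : closed U -> measurable U.
Proof. by move=> /closed_openC/measurable_open_mx/measurableC; rewrite setCK. Qed.

Lemma rat_mx_approx (x : M) (r : R) : 0 < r ->
  exists a : 'M[rat]_(m, n), ball (map_mx ratr a : M) r x.
Proof.
move=> r0.
have /choice[f Hf] : forall ij : 'I_m * 'I_n,
    exists q : rat, `|ratr q - x ij.1 ij.2| < r.
  move=> [i j] /=; have : x i j - r < x i j + r by lra.
  by move=> /rat_in_itvoo[q]; rewrite in_itv/= => qx; exists q; rewrite ltr_distl.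
exists (\matrix_(i, j) f (i, j)); split=> // i j.
by rewrite !mxE; exact: (Hf (i, j)).
Qed.

Lemma measurable_open_prod_mx (W : set (M * M)) :
  open W -> measurable W.
Proof.
move=> oW.
pose B (k : 'M[rat]_(m, n) * 'M[rat]_(m, n) * rat) : set (M * M) :=
  (ball (map_mx ratr k.1.1 : M) (ratr k.2 : R))° `*`
  (ball (map_mx ratr k.1.2 : M) (ratr k.2 : R))°.
have -> : W = \bigcup_(k in [set k | B k `<=` W]) B k.
  apply/seteqP; split => [[x y] Wxy|z [k /= kW /kW//]].
  move: oW; rewrite openE => /(_ _ Wxy); rewrite /interior -nbhs_ballE.
  move=> [e /= e0 eW].
  have [q] : exists q : rat, ratr q \in `]0, (e / 2)[.
    by apply: rat_in_itvoo; lra.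
  rewrite in_itv/= => /andP[q0 qe].
  have [a ax] := rat_mx_approx x q0; have [b yb] := rat_mx_approx y q0.
  exists (a, b, q) => /=.
    move=> [u v] [/= /interior_subset au /interior_subset bv]; apply: eW.
    by split=> /=; apply: (@le_ball _ _ _ (ratr q + ratr q)); rewrite ?(ltW _)//;
      [lra| apply: ball_triangle (ball_sym _) au|lra|
       apply: ball_triangle (ball_sym _) bv].
  have op (c : M) (z : M) : ball c (ratr q : R) z -> (ball c (ratr q))° z.
    by rewrite (_ : (ball c _)° = ball c (ratr q))//; apply/interior_id/ball_open.
  by split => /=; apply: op.
rewrite bigcup_mkcond; apply: countable_bigcupT_measurable => // k.
case: ifP => // _; apply: measurableX; apply: measurable_open_mx;
  exact: open_interior.
Qed.

Lemma measurable_add_mx : measurable_fun setT (fun z : M * M => z.1 + z.2).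
Proof.
apply: (@measurability _ _ _ _ _ _ (@open M)) => // _ [U oU <-]; rewrite setTI.
apply: measurable_open_prod_mx; apply: open_comp => // z _.
exact: add_continuous.
Qed.

End borel_matrix.

Section jordan_parts.
Local Open Scope ereal_scope.
Context d (T : measurableType d) (R : realType).
Variable nu : {charge set T -> \bar R}.

Lemma hahn_sig : {PN : set T * set T | hahn_decomposition nu PN.1 PN.2}.
Proof.
by apply: cid; have [P [N PN]] := Hahn_decomposition nu; exists (P, N).
Qed.

Definition pos_part : {finite_measure set T -> \bar R} :=
  jordan_pos (svalP hahn_sig).

Definition neg_part : {finite_measure set T -> \bar R} :=
  jordan_neg (svalP hahn_sig).

Lemma charge_partsE A : measurable A -> nu A = pos_part A - neg_part A.
Proof.
move=> mA; rewrite (jordan_decomp (svalP hahn_sig) mA) /cadd /=.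
by rewrite cscaleN1.
Qed.

Lemma parts_le (a b : set T -> \bar R) (ca cb : \bar R) :
  (forall A, measurable A -> 0 <= a A <= ca) ->
  (forall A, measurable A -> 0 <= b A <= cb) ->
  (forall A, measurable A -> nu A = a A - b A) ->
  pos_part setT + neg_part setT <= ca + cb.
Proof.
move=> ha hb nuab.
have [[mP _] [mN _] _ _] := svalP hahn_sig.
apply: leeD.
- rewrite /pos_part/= jordan_posE cjordan_posE /crestr0 mem_set//= /crestr setTI.
  rewrite nuab//; have /andP[_ aP] := ha _ mP; have /andP[bP _] := hb _ mP.
  by apply: le_trans aP; rewrite geeDl// oppe_le0.
- rewrite /neg_part/= jordan_negE cjordan_negE /crestr0 mem_set//= /crestr setTI.
  rewrite nuab//; have /andP[aN _] := ha _ mN; have /andP[_ bN] := hb _ mN.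
  by apply: le_trans bN; rewrite leeNl leeDr.
Qed.

End jordan_parts.

Section signed_measures.
Local Open Scope ereal_scope.
Context (R : realType) (d : nat).
Local Notation V := 'rV[R]_d.
Local Notation smeasure := ({charge set V -> \bar R})%R.

Local Definition add_preim (A : set V) : set (V * V) := (fun z => z.1 + z.2)%R @^-1` A.

Local Lemma measurable_add_preim A : measurable A -> measurable (add_preim A).
Proof.
by move=> mA; rewrite -[X in measurable X]setTI; exact: measurable_add_mx.
Qed.

(* The image under addition of the product signed measure M (x) N, the latter
   being expanded by bilinearity along the Jordan decompositions. *)
Definition convolution (M N : smeasure) (A : set V) : \bar R :=
  let S := add_preim A in
    ((pos_part M \x pos_part N) S + (neg_part M \x neg_part N) S)
  - ((pos_part M \x neg_part N) S + (neg_part M \x pos_part N) S).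

Section charge_conv.
Variables M N : smeasure.

Let prod_fin (m1 m2 : {finite_measure set V -> \bar R}) S :
  measurable S -> 0 <= (m1 \x m2) S <= m1 setT * m2 setT.
Proof.
move=> mS; apply/andP; split; first exact: measure_ge0.
rewrite -product_measure1E// setXTT.
by apply: le_measure; rewrite ?inE.
Qed.

Let prod_fin_num (m1 m2 : {finite_measure set V -> \bar R}) S :
  measurable S -> (m1 \x m2) S \is a fin_num.
Proof.
move=> mS; have /andP[m0 mle] := prod_fin m1 m2 mS.
rewrite ge0_fin_numE//; apply: le_lt_trans mle _.
by rewrite ltey_eq fin_numM// fin_num_measure.
Qed.

Let conv0 : convolution M N set0 = 0.
Proof.
by rewrite /convolution /add_preim preimage_set0 !measure0 adde0 sube0.
Qed.

Let conv_finite A : measurable A -> convolution M N A \is a fin_num.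
Proof.
move=> /measurable_add_preim mA.
by rewrite /convolution fin_numB; apply/andP; split; rewrite fin_numD !prod_fin_num.
Qed.

Let conv_sigma_additive : semi_sigma_additive (convolution M N).
Proof.
move=> F mF tF mUF.
have mG n := measurable_add_preim (mF n).
have tG : trivIset setT (fun n => add_preim (F n)).
  apply/trivIsetP => /= i j _ _ ij; rewrite -preimage_setI.
  by move/trivIsetP : tF => /(_ _ _ _ _ ij) ->//; rewrite preimage_set0.
have mUG := measurable_add_preim mUF.
have UG : add_preim (\bigcup_n F n) = \bigcup_n add_preim (F n).
  by rewrite /add_preim preimage_bigcup.
have cv (m1 m2 : {finite_measure set V -> \bar R}) :
    (fun n => \sum_(0 <= i < n) (m1 \x m2) (add_preim (F i))) @ \oo -->
      (m1 \x m2) (add_preim (\bigcup_n F n)).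
  by rewrite UG; apply: measure_semi_sigma_additive => //; rewrite -UG.
have fs (m1 m2 : {finite_measure set V -> \bar R}) n :
    \sum_(0 <= i < n) (m1 \x m2) (add_preim (F i)) \is a fin_num.
  by apply/sum_fin_numP => i _ _; exact: prod_fin_num.
rewrite [X in X @ _ --> _](_ : _ = fun n =>
  (\sum_(0 <= i < n) (pos_part M \x pos_part N) (add_preim (F i)) +
   \sum_(0 <= i < n) (neg_part M \x neg_part N) (add_preim (F i))) -
  (\sum_(0 <= i < n) (pos_part M \x neg_part N) (add_preim (F i)) +
   \sum_(0 <= i < n) (neg_part M \x pos_part N) (add_preim (F i)))); last first.
  apply/funext => n; rewrite /convolution big_split/= sumeN; last first.
    by move=> i j _ _; rewrite fin_num_adde_defl// fin_numD 2?prod_fin_num.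
  by rewrite !big_split.
apply: cvgeB.
- by rewrite fin_num_adde_defl// fin_numN fin_numD !prod_fin_num.
- by apply: cvgeD; [rewrite fin_num_adde_defl// prod_fin_num|exact: cv|exact: cv].
- by apply: cvgeD; [rewrite fin_num_adde_defl// prod_fin_num|exact: cv|exact: cv].
Qed.

HB.instance Definition _ := isCharge.Build _ _ _ (convolution M N)
  conv0 conv_finite conv_sigma_additive.

Lemma conv_parts_le :
  pos_part (convolution M N : smeasure) setT + neg_part (convolution M N : smeasure) setT <=
  (pos_part M setT + neg_part M setT) * (pos_part N setT + neg_part N setT).
Proof.
have fM := @fin_num_measure _ _ _ (pos_part M) setT measurableT.
have fM' := @fin_num_measure _ _ _ (neg_part M) setT measurableT.
have fN := @fin_num_measure _ _ _ (pos_part N) setT measurableT.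
have fN' := @fin_num_measure _ _ _ (neg_part N) setT measurableT.
rewrite ge0_muleDl// !ge0_muleDr//.
set a := _ * _; set b := _ * _; set c := _ * _; set e := _ * _.
rewrite (_ : a + b + (c + e) = (a + e) + (b + c)); last first.
  by rewrite (addeC c e) addeACA.
apply: (@parts_le _ _ _ _
  (fun A => (pos_part M \x pos_part N) (add_preim A) +
            (neg_part M \x neg_part N) (add_preim A))
  (fun A => (pos_part M \x neg_part N) (add_preim A) +
            (neg_part M \x pos_part N) (add_preim A))) => // A mA;
  have := measurable_add_preim mA => {}mA.
- have /andP[h1 h2] := prod_fin (pos_part M) (pos_part N) mA.
  have /andP[h3 h4] := prod_fin (neg_part M) (neg_part N) mA.
  by apply/andP; split; [exact: adde_ge0|exact: leeD].
- have /andP[h1 h2] := prod_fin (pos_part M) (neg_part N) mA.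
  have /andP[h3 h4] := prod_fin (neg_part M) (pos_part N) mA.
  by apply/andP; split; [exact: adde_ge0|exact: leeD].
Qed.

End charge_conv.

Definition unit_mass : smeasure := charge_of_finite_measure \d_(0%R : V).

Definition convpow (M : smeasure) (j : nat) : smeasure :=
  iter j (fun N : smeasure => convolution M N : smeasure) unit_mass.

Definition cexp (M : smeasure) (A : set V) : \bar R :=
  \sum_(0 <= j <oo) (j`!%:R^-1)%:E * convpow M j A.

Section charge_cexp.
Variable M : smeasure.

Let c : R := fine (pos_part M setT + neg_part M setT).

Let convpow_parts_le j :
  pos_part (convpow M j) setT + neg_part (convpow M j) setT <= (c ^+ j)%:E.
Proof.
elim: j => [|j IHj]; last first.
  apply: le_trans (conv_parts_le M (convpow M j)) _.
  rewrite exprS EFinM /c fineK; last by rewrite fin_numD !fin_num_measure.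
  by apply: lee_wpmul2l => //; exact: adde_ge0.
rewrite expr0 -[leRHS]adde0; apply: (@parts_le _ _ _ _ \d_(0%R : V) (cst 0)).
- move=> A mA; rewrite measure_ge0/= diracE lee_fin.
  by case: (_ \in _).
- by move=> A mA; rewrite lexx.
- by move=> A mA; rewrite /= sube0.
Qed.

Let sum_fin (m : {finite_measure set V -> \bar R}^nat) :
  (forall j, m j setT <= (c ^+ j)%:E) ->
  mseries (fun j => mscale ((j`!%:R^-1)%:nng)%R (m j)) 0 setT \is a fin_num.
Proof.
move=> mc; rewrite ge0_fin_numE//.
apply: (@le_lt_trans _ _ (\sum_(0 <= j <oo) (exp_coeff c j)%:E)).
  apply: lee_nneseries => [j _ _|j _]; first exact: measure_ge0.
  rewrite /mscale/= /exp_coeff/= mulrC EFinM.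
  by apply: lee_wpmul2l; [rewrite lee_fin|exact: mc].
rewrite (_ : \sum_(0 <= j <oo) _ = (limn (series (exp_coeff c)))%:E) ?ltry//.
rewrite -EFin_lim; last exact: is_cvg_series_exp_coeff.
by congr (limn _); apply/funext => n /=; rewrite sumEFin.
Qed.

Let epos := mseries
  (fun j => mscale ((j`!%:R^-1)%:nng)%R (pos_part (convpow M j))) 0.
Let eneg := mseries
  (fun j => mscale ((j`!%:R^-1)%:nng)%R (neg_part (convpow M j))) 0.

Let epos_fin A : measurable A -> epos A \is a fin_num.
Proof.
move=> mA; have h : epos setT \is a fin_num.
  apply: sum_fin => j; apply: le_trans (convpow_parts_le j).
  by rewrite leeDl.
rewrite ge0_fin_numE//; apply: (@le_lt_trans _ _ (epos setT)).
  by apply: le_measure; rewrite ?inE.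
by rewrite -ge0_fin_numE.
Qed.

Let eneg_fin A : measurable A -> eneg A \is a fin_num.
Proof.
move=> mA; have h : eneg setT \is a fin_num.
  apply: sum_fin => j; apply: le_trans (convpow_parts_le j).
  by rewrite leeDr.
rewrite ge0_fin_numE//; apply: (@le_lt_trans _ _ (eneg setT)).
  by apply: le_measure; rewrite ?inE.
by rewrite -ge0_fin_numE.
Qed.

Let cvg_parts A : measurable A ->
  (fun n => \sum_(0 <= j < n) (j`!%:R^-1)%:E * convpow M j A) @ \oo -->
  epos A - eneg A.
Proof.
move=> mA.
have fp j : pos_part (convpow M j) A \is a fin_num by rewrite fin_num_measure.
have fn j : neg_part (convpow M j) A \is a fin_num by rewrite fin_num_measure.
rewrite [X in X @ _ --> _](_ : _ = fun n =>
  \sum_(0 <= j < n) (j`!%:R^-1)%:E * pos_part (convpow M j) A -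
  \sum_(0 <= j < n) (j`!%:R^-1)%:E * neg_part (convpow M j) A); last first.
  apply/funext => n; rewrite -sumeN; last first.
    by move=> i j _ _; rewrite fin_num_adde_defl// fin_numM.
  rewrite -big_split/=; apply: eq_bigr => j _.
  by rewrite (charge_partsE _ mA) muleBr// fin_num_adde_defl// fin_numN.
apply: cvgeB.
- by rewrite fin_num_adde_defl// fin_numN eneg_fin.
- by apply: is_cvg_nneseries => j _ _; rewrite mule_ge0// lee_fin.
- by apply: is_cvg_nneseries => j _ _; rewrite mule_ge0// lee_fin.
Qed.

Let cexpE A : measurable A -> cexp M A = epos A - eneg A.
Proof. by move=> /cvg_parts h; rewrite /cexp (cvg_lim _ h). Qed.

Let cexp0 : cexp M set0 = 0.
Proof.
have -> : cexp M set0 = epos set0 - eneg set0 by exact: cexpE.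
by rewrite [epos _]measure0 [eneg _]measure0 sube0.
Qed.

Let cexp_finite A : measurable A -> cexp M A \is a fin_num.
Proof. by move=> mA; rewrite cexpE// fin_numB epos_fin// eneg_fin. Qed.

Let cexp_sigma_additive : semi_sigma_additive (cexp M).
Proof.
move=> F mF tF mUF.
rewrite cexpE// [X in X @ _ --> _](_ : _ = fun n =>
  \sum_(0 <= i < n) epos (F i) - \sum_(0 <= i < n) eneg (F i)); last first.
  apply/funext => n; rewrite -sumeN; last first.
    by move=> i j _ _; rewrite fin_num_adde_defl// eneg_fin.
  by rewrite -big_split/=; apply: eq_bigr => i _; rewrite cexpE.
apply: cvgeB.
- by rewrite fin_num_adde_defl// fin_numN eneg_fin.
- exact: measure_semi_sigma_additive.
- exact: measure_semi_sigma_additive.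
Qed.

HB.instance Definition _ := isCharge.Build _ _ _ (cexp M)
  cexp0 cexp_finite cexp_sigma_additive.

Lemma cvg_cexp A : measurable A ->
  (fun n => \sum_(0 <= j < n) (j`!%:R^-1)%:E * convpow M j A) @ \oo -->
  cexp M A.
Proof. by move=> mA; rewrite cexpE//; exact: cvg_parts. Qed.

End charge_cexp.

End signed_measures.

Section lattice.
Context (R : realType) (d : nat).
Local Notation V := 'rV[R]_d.
Local Notation smeasure := ({charge set V -> \bar R})%R.

Definition lattice_pt (z : 'rV[int]_d) : V := map_mx intr z.

(* Only the lattice atoms of M are counted: this is the total variation norm
   when M is concentrated on the lattice. *)
Definition tv_norm (M : set V -> \bar R) : \bar R :=
  \esum_(z in [set: 'rV[int]_d]) `|M [set lattice_pt z]|%E.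

Section distribution.
Variable F : probability V R.

Definition mass (x : V) : R := fine (F [set x]).

Definition supp : set V :=
  [set x | forall U : set V, open U -> U x -> (0 < F U)%E].

Definition symmetric_distr : Prop :=
  forall z : 'rV[int]_d, mass (lattice_pt z) = mass (- lattice_pt z).

Definition delta (y : R) : R :=
  fine (\esum_(x in supp `\ 0) (Num.min 1 (4 * y * mass x))%:E).

Definition charge_distr : smeasure := charge_of_finite_measure F.

Definition centered : smeasure :=
  cadd charge_distr (copp (unit_mass R d)).

Definition approxD : smeasure :=
  cexp (cadd centered (cscale (- 2^-1) (convpow centered 2))).

Definition error (n k : nat) (A : set V) : \bar R :=
  (convpow charge_distr n A -
   \sum_(m < k.+1) 'C(n, m)%:R%:E *
     convolution (convpow approxD (n - m))
          (convpow (cadd charge_distr (copp approxD)) m) A)%E.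

End distribution.

End lattice.

(* Main.v *)
(** Put [w = F - I], [q = F{0}] and [w = (1 - q) (G - I)], in the convolution
    algebra of finite signed measures on the lattice.  By Bergstrom's identity
    [M_k] is the sum over [i < n - k] of
    [binomial (i + k) k * F^(n-k-1-i) * D^i * (F - D)^(k+1)], and [F - D] is
    [w^3] times a factor of bounded norm.  Since [D = exp (w - w^2 / 2)], the
    power [D^b] splits into [exp (b q w / 2)], which is the exponential of a
    multiple of [F - I] and hence smooths as [F^a] does, and the exponential of
    [b ((1 - q / 2) w - w^2 / 2)].  The norm of the latter is at most [4 / q]:
    expand it in powers of [(G - I)^2] around a binomial law and use the exact
    weighted square norms of the Krawtchouk polynomials, which make the
    expansion a geometric series.  Smoothing is done one pair of atoms at a
    time: by symmetry [w] is half the sum of the [p_x (E_x + E_-x - 2 I)], where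
    [E_x] is the unit mass at [x], and each summand times [F^a] has norm at most
    [min (4 p_x, 2 / ((a + 1) q))], because [F^a] dominates a binomial number of
    steps of a lazy walk with steps [x] and [-x].  This yields
    [delta (n q) / (n q)] for each of the [3 (k + 1)] factors [w].  The
    exponentials are handled as norm limits of products [(A_m B_m)^m]. *)

From HB Require Import structures.
Require Import Defs.
From mathcomp Require Import all_boot all_order all_algebra.
From mathcomp Require Import all_classical all_reals all_analysis.
From mathcomp Require Import ring lra zify.

Set Implicit Arguments.
Unset Strict Implicit.
Unset Printing Implicit Defensive.
Import Order.TTheory GRing.Theory Num.Theory.
Import numFieldNormedType.Exports.
Local Open Scope classical_set_scope.
Local Open Scope ring_scope.

(** * Algebraic identities *)

(** When b exceeds a, [D ^+ b] has two jobs. Its term - w^2 / 2 contributes a norm of order b to the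
    exponent, so it can only be controlled against the linear term, and yet part of the linear term
    is wanted for smoothing. What decides is twice the coefficient of -(G - I)^2 divided by the
    coefficient of G - I. With all of w kept this ratio is 1 - q; with q w / 2 set aside it is (1 -
    q) / (1 - q / 2), still at most 1 - q / 2. Hence the reserve q / 2, and a loss of one factor 1 /
    q for the whole product. As q tends to 0 the ratio tends to 1, so losing a constant factor in
    the Krawtchouk norms would make the series diverge; this is why they are computed exactly.

    Krawtchouk bounds concern polynomials in G, so exponentials are discretised into m steps and
    every estimate is kept uniform in m. The factor w^3 of F - D, on the other hand, is visible in
    the partial sums of the exponential series. Both approximations of D are therefore used in the
    same product, and only the final norm bound passes to the limit. *)

Lemma bergstrom_identity (A : comNzRingType) (x y : A) (n k : nat) : (k <= n)%N ->
  x ^+ n - \sum_(m < k.+1) 'C(n, m)%:R * (y ^+ (n - m) * (x - y) ^+ m) =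
  (x - y) ^+ k.+1 *
    \sum_(i < n - k) 'C(i + k, k)%:R * (x ^+ (n - k.+1 - i) * y ^+ i).
Proof.
move=> /subnKC <-; move: (n - k)%N => j; rewrite addnC.
pose S n' l := \sum_(m < l) 'C(n', m)%:R * (y ^+ (n' - m) * (x - y) ^+ m) : A.
have Sr n' l : S n' l.+1 =
    S n' l + 'C(n', l)%:R * (y ^+ (n' - l) * (x - y) ^+ l) by rewrite /S big_ord_recr.
(* Pascal's rule for the truncated binomial sum. *)
have SS n' l : (l <= n')%N -> S n'.+1 l.+1 = y * S n' l.+1 + (x - y) * S n' l.
  elim: l => [|l IH] ln; first by rewrite !Sr /S !big_ord0 /= !bin0 !subn0 exprS; ring.
  rewrite Sr IH; last exact: ltnW.
  rewrite [S n' l.+2]Sr [S n' l.+1]Sr binS natrD.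
  have -> : (n'.+1 - l.+1 = (n' - l.+1).+1)%N by lia.
  have -> : (n' - l = (n' - l.+1).+1)%N by lia.
  rewrite !exprS; ring.
rewrite -/(S _ _); elim: j => [|j IH].
  rewrite add0n subnn big_ord0 mulr0; apply/eqP; rewrite subr_eq0; apply/eqP.
  rewrite -[x in LHS](subrKC y) exprDn.
  by apply/eq_bigr => i _; rewrite mulr_natl.
(* Raising n by one multiplies the remainder by x and adds a boundary term, which becomes the
   summand of index j. At n = k the sum is the whole binomial expansion and the remainder
   vanishes. *)
have -> : x ^+ (j.+1 + k) - S (j.+1 + k)%N k.+1 =
    x * (x ^+ (j + k) - S (j + k)%N k.+1) +
    (x - y) * ('C(j + k, k)%:R * (y ^+ j * (x - y) ^+ k)).
  rewrite addSn SS ?leq_addl// Sr addnK exprS; ring.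
rewrite IH !addnK big_ord_recr/= (_ : j.+1 + k - k.+1 - j = 0)%N; last by lia.
rewrite expr0 mulrDr [x * _]mulrCA mulr_sumr; congr (_ * _ + _); last first.
  by rewrite exprS; ring.
apply: eq_bigr => -[i /= ij] _.
rewrite (_ : j.+1 + k - k.+1 - i = (j + k - k.+1 - i).+1)%N; last by lia.
by rewrite exprS; ring.
Qed.

(** * Krawtchouk polynomials *)

Section binomial_weights.
Variables (R : realFieldType) (t : R).
Hypothesis t01 : 0 < t < 1.

Let t0 : t != 0. Proof. by case/andP: t01 => /gt_eqF ->. Qed.
Let t1 : 1 - t != 0. Proof. by case/andP: t01 => _; rewrite -subr_gt0 => /gt_eqF ->. Qed.

Definition binomial_weight (M j : nat) : R := 'C(M, j)%:R * t ^+ j * (1 - t) ^+ (M - j).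

(** The reciprocal weight makes this the inner product, under the binomial law, of the coefficient
    sequences divided by the weights. *)
Definition binomial_form (M : nat) (P Q : {poly R}) : R :=
  \sum_(j < M.+1) P`_j * Q`_j / binomial_weight M j.

Lemma binomial_weight_gt0 M j : (j <= M)%N -> 0 < binomial_weight M j.
Proof.
case/andP: t01 => ? ? jM.
by rewrite /binomial_weight !mulr_gt0 ?exprn_gt0 ?ltr0n ?bin_gt0 ?subr_gt0.
Qed.

Lemma sum_binomial_weight M : \sum_(j < M.+1) binomial_weight M j = 1.
Proof.
rewrite -[RHS](expr1n _ M) -[X in X ^+ _](subrK t 1) exprDn.
by apply: eq_bigr => j _; rewrite /binomial_weight -mulr_natl; ring.
Qed.

Lemma binomial_weightS M j : (j <= M)%N ->
  binomial_weight M.+1 j.+1 = M.+1%:R * t * binomial_weight M j / j.+1%:R.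
Proof.
move=> jM; rewrite /binomial_weight subSS exprS.
have := congr1 (fun n => n%:R : R) (mul_bin_diag M.+1 j); rewrite /= !natrM => h.
apply: (mulIf (_ : j.+1%:R != 0 :> R)); rewrite ?divfK ?pnatr_eq0//.
transitivity (j.+1%:R * 'C(M.+1, j.+1)%:R * (t * t ^+ j * (1 - t) ^+ (M - j))).
  by ring.
by rewrite -h; ring.
Qed.

Lemma binomial_weightSn M j : (j <= M)%N ->
  binomial_weight M.+1 j =
  M.+1%:R * (1 - t) * binomial_weight M j / (M.+1 - j)%:R.
Proof.
move=> jM; rewrite /binomial_weight subSn// exprS.
have := congr1 (fun n => n%:R : R) (mul_bin_down M.+1 j).
rewrite /= !natrM subSn// => h.
apply: (mulIf (_ : (M - j).+1%:R != 0 :> R)); rewrite ?divfK ?pnatr_eq0//.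
transitivity ((M - j).+1%:R * 'C(M.+1, j)%:R * (t ^+ j * ((1 - t) * (1 - t) ^+ (M - j)))).
  by ring.
by rewrite -h; ring.
Qed.

(* Multiplication by ['X - 1] is adjoint to a first order operator; this is the
   orthogonality of the Krawtchouk polynomials. *)
Lemma binomial_form_adjoint M (P Q : {poly R}) : (size P <= M.+1)%N ->
  binomial_form M.+1 (('X - 1) * P) Q =
  M.+1%:R^-1 * binomial_form M P
    (t^-1 *: deriv Q - (1 - t)^-1 *: (M.+1%:R *: Q - 'X * deriv Q)).
Proof.
move=> sP; rewrite /binomial_form mulr_sumr.
under eq_bigr => j _ do rewrite mulrBl mul1r coefB !mulrBl.
rewrite sumrB big_ord_recl coefXM /= !mul0r add0r.
rewrite [X in _ - X]big_ord_recr /= (nth_default 0 sP) !mul0r addr0 -sumrB.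
apply: eq_bigr => -[j /= jM] _; rewrite coefXM /bump leq0n add1n /=.
rewrite coefB !coefZ coefB coefZ coefXM !coef_deriv.
have -> : (if j == 0%N then 0 else Q`_j.-1.+1 *+ j.-1.+1) = Q`_j *+ j.
  by case: j {jM} => [|j] //=.
rewrite ltnS in jM.
rewrite binomial_weightS// binomial_weightSn// natrB; last lia.
have := binomial_weight_gt0 jM; move: (binomial_weight M j) => u u0.
rewrite -[Q`_j.+1 *+ _]mulr_natl -[Q`_j *+ _]mulr_natl.
have M1 : M.+1%:R != 0 :> R by rewrite pnatr_eq0.
have j1 : j.+1%:R != 0 :> R by rewrite pnatr_eq0.
have Mj : M.+1%:R - j%:R != 0 :> R by rewrite -natrB ?pnatr_eq0; lia.
move: (M.+1%:R : R) (j.+1%:R : R) (j%:R : R) M1 j1 Mj => m j' jj m0 j'0 mj.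
by field; rewrite t0 t1 m0 j'0 mj gt_eqF.
Qed.

Lemma coef_binomial_poly L j : (j <= L)%N ->
  (((1 - t)%:P + t *: 'X) ^+ L)`_j = binomial_weight L j.
Proof.
move=> jL; rewrite exprDn coef_sum (bigD1 (Ordinal (jL : (j < L.+1)%N)))//= big1 ?addr0.
  rewrite -polyC_exp coefMn coefCM exprZn coefZ coefXn eqxx /binomial_weight.
  by rewrite -[_ *+ 'C(L, j)]mulr_natl mulr1; ring.
move=> [i /= iL] /eqP ij; rewrite -polyC_exp coefMn coefCM exprZn coefZ coefXn.
rewrite (_ : (j == i) = false) ?mulr0 ?mul0rn//.
by apply/eqP => h; apply: ij; apply/val_inj.
Qed.

(** The coefficients are r-th differences of a binomial law of order L; divided by the weights of
    order r + L they are, up to normalisation, the values of the Krawtchouk polynomial of degree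
    r. *)
Definition krawtchouk r L : {poly R} := ('X - 1) ^+ r * ((1 - t)%:P + t *: 'X) ^+ L.

Lemma size_krawtchouk r L : (size (krawtchouk r L) <= (r + L).+1)%N.
Proof.
have sf : (size ((1 - t)%:P + t *: 'X)%R <= 2)%N.
  rewrite (leq_trans (size_polyD _ _))// geq_max (leq_trans (size_polyC_leq1 _))//.
  by rewrite (leq_trans (size_scale_leq _ _))// size_polyX.
have se : (size ('X - 1 : {poly R})%R = 2)%N by rewrite -polyC1 size_XsubC.
rewrite /krawtchouk (leq_trans (size_polyMleq _ _))//.
have := size_poly_exp_leq ('X - 1 : {poly R}) r; rewrite se /= mul1n => h1.
have := size_poly_exp_leq ((1 - t)%:P + t *: 'X) L => h2.
have h3 : ((size ((1 - t)%:P + t *: 'X)%R).-1 * L <= L)%N.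
  by rewrite -[leqRHS]mul1n leq_mul2r -subn1 leq_subLR addn1 sf orbT.
rewrite -subn1 leq_subLR add1n.
have -> : ((r + L).+2 = r.+1 + L.+1)%N by rewrite addSn addnS.
by rewrite leq_add// (leq_trans h2).
Qed.

(** Induction on r: the adjoint of multiplication by ['X - 1] sends [krawtchouk r.+1 L] to an
    explicit multiple of [krawtchouk r L]. At r = 0 the form is the total mass of the law. *)
Lemma krawtchouk_norm r L :
  binomial_form (r + L) (krawtchouk r L) (krawtchouk r L) =
  ('C(r + L, r)%:R * (t * (1 - t)) ^+ r)^-1.
Proof.
elim: r => [|r IH].
  rewrite add0n bin0 expr0 mulr1 invr1 -(sum_binomial_weight L) /binomial_form.
  apply: eq_bigr => -[j /= jL] _; rewrite /krawtchouk expr0 mul1r coef_binomial_poly//.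
  by rewrite mulfK// gt_eqF// binomial_weight_gt0.
have kS : krawtchouk r.+1 L = ('X - 1) * krawtchouk r L by rewrite /krawtchouk exprS mulrA.
rewrite addSn {1}kS binomial_form_adjoint ?size_krawtchouk//.
set f := (1 - t)%:P + t *: 'X : {poly R}.
have -> : t^-1 *: deriv (krawtchouk r.+1 L) - (1 - t)^-1 *:
    ((r + L).+1%:R *: krawtchouk r.+1 L - 'X * deriv (krawtchouk r.+1 L)) =
    (r.+1%:R / (t * (1 - t))) *: krawtchouk r L.
  have -> : deriv (krawtchouk r.+1 L) = r.+1%:R *: krawtchouk r L +
      (t * L%:R) *: (('X - 1) ^+ r.+1 * f ^+ L.-1).
    have de : deriv ('X - 1 : {poly R}) = 1 by rewrite derivB derivX derivC subr0.
    have df : deriv f = t%:P by rewrite /f derivD derivC derivZ derivX add0r alg_polyC.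
    rewrite /krawtchouk -/f derivM !deriv_exp de df mul1r /=.
    rewrite -[_ *+ r.+1]mulr_natl -[_ *+ L]mulr_natl -!mul_polyC !rmorphM /= !polyC_natr.
    by rewrite ?alg_polyC; ring.
  (* The factor L covers L = 0, where [L.-1] is 0 and [f ^+ L.-1 * f] is not [f ^+ L]. *)
  have fL : f ^+ L.-1 * f * L%:R%:P = f ^+ L * L%:R%:P.
    by case: {IH kS} L => [|L]; rewrite ?mulr0//= exprSr.
  set e := 'X - 1; set e1 := e ^+ r; set g := f ^+ L; set g1 := f ^+ L.-1 in fL *.
  rewrite /krawtchouk -/f -/e -/g exprS -/e1 -!mul_polyC !polyCM !polyC_natr.
  have a1 : t%:P * t^-1%:P = 1 :> {poly R} by rewrite -polyCM mulfV.
  have b1 : (1 - t)%:P * (1 - t)^-1%:P = 1 :> {poly R} by rewrite -polyCM mulfV.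
  rewrite (_ : (t * (1 - t))^-1 = t^-1 * (1 - t)^-1) ?invfM// polyCM.
  set a := t%:P in a1 *; set b := (1 - t)%:P in b1 *.
  have ab : a + b = 1 by rewrite -polyCD addrC subrK.
  have fE : f = b + a * 'X by rewrite /f -mul_polyC.
  move: (t^-1)%:P ((1 - t)^-1)%:P a1 b1 => ia ib a1 b1.
  rewrite polyC_natr -/g in fL.
  (* [K'] is the derivative of [krawtchouk r.+1 L]. *)
  set K' := r.+1%:R * (e1 * g) + a * L%:R * (e * e1 * g1).
  have -> : (r + L).+1%:R = r%:R + L%:R + 1%:R :> {poly R} by rewrite -addn1 !natrD.
  have -> : r.+1%:R = r%:R + 1 :> {poly R} by rewrite -addn1 natrD.
  have -> : ia * K' - ib * ((r%:R + L%:R + 1%:R) * (e * e1 * g) - 'X * K') =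
      ia * ib * (f * K') - ib * (r%:R + 1 + L%:R) * (e * e1 * g).
    transitivity ((ia * (b * ib) + 'X * ib * (a * ia)) * K' -
        ib * (r%:R + 1 + L%:R) * (e * e1 * g)).
      by rewrite a1 b1; ring.
    by rewrite fE; ring.
  have -> : f * K' = (r%:R + 1) * e1 * g * f + a * e * e1 * (g * L%:R).
    by rewrite -fL /K' -[r.+1]addn1 natrD; ring.
  transitivity (ib * (r%:R + 1) * e1 * g * (ia * f - e) +
      (a * ia - 1) * ib * e * e1 * g * L%:R).
    by ring.
  have -> : ia * f - e = ia.
    rewrite fE /e mulrDr mulrA [ia * a]mulrC a1 -(mulr1 ia) -ab; ring: a1.
  by rewrite a1; ring.
have formZ c P Q : binomial_form (r + L) P (c *: Q) = c * binomial_form (r + L) P Q.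
  by rewrite /binomial_form mulr_sumr; apply: eq_bigr => j _; rewrite coefZ; ring.
rewrite formZ IH exprS.
have h := congr1 (fun n => n%:R : R) (mul_bin_diag (r + L).+1 r); rewrite /= !natrM in h.
have C0 : 'C(r + L, r)%:R != 0 :> R by rewrite pnatr_eq0 -lt0n bin_gt0 leq_addr.
have -> : 'C((r + L).+1, r.+1)%:R = (r + L).+1%:R * 'C(r + L, r)%:R / r.+1%:R :> R.
  by rewrite h mulrC mulKf// pnatr_eq0.
have M1 : (r + L).+1%:R != 0 :> R by rewrite pnatr_eq0.
have r1 : r.+1%:R != 0 :> R by rewrite pnatr_eq0.
have T0 : (t * (1 - t)) ^+ r != 0 by rewrite expf_neq0 ?mulf_neq0.
move: ((t * (1 - t)) ^+ r) T0 ((r + L).+1%:R : R) M1 (r.+1%:R : R) r1 => u u0 m m0 r' r'0.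
by field; rewrite u0 t0 t1 C0 m0 r'0.
Qed.

(* Cauchy-Schwarz, in the form of the nonnegativity of a variance. *)
Lemma sum_krawtchouk_coef_sqr_le r L :
  (\sum_(j < (r + L).+1) `|(krawtchouk r L)`_j|) ^+ 2 <=
  ('C(r + L, r)%:R * (t * (1 - t)) ^+ r)^-1.
Proof.
rewrite -krawtchouk_norm; set P := krawtchouk r L; set M := (r + L)%N.
set S := \sum_(j < _) _; rewrite -subr_ge0.
suff -> : binomial_form M P P - S ^+ 2 =
  \sum_(j < M.+1) binomial_weight M j * (`|P`_j| / binomial_weight M j - S) ^+ 2.
  apply: sumr_ge0 => -[j /= jM] _.
  by rewrite mulr_ge0 ?sqr_ge0// ltW// binomial_weight_gt0.
have -> : \sum_(j < M.+1) binomial_weight M j * (`|P`_j| / binomial_weight M j - S) ^+ 2 =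
  \sum_(j < M.+1) (P`_j * P`_j / binomial_weight M j - 2 * S * `|P`_j| +
     S ^+ 2 * binomial_weight M j).
  apply: eq_bigr => -[j /= jM] _; have := binomial_weight_gt0 (jM : (j <= M)%N).
  move=> /gt_eqF/negbT w0; rewrite -[P`_j * _]expr2 -(real_normK (num_real P`_j)).
  by field.
rewrite big_split /= sumrB -!mulr_sumr sum_binomial_weight -/S /binomial_form; ring.
Qed.

End binomial_weights.

(** * Normed commutative algebras *)

(** Models total variation under convolution. In an abstract commutative algebra the identities
    between measures become ring identities, and measure theory stays out of the estimates. *)
Record algebra_norm (R : realFieldType) (A : comAlgType R) := AlgebraNorm {
  algnorm :> A -> R;
  algnormD : forall x y, algnorm (x + y) <= algnorm x + algnorm y;
  algnormZ : forall a x, algnorm (a *: x) = `|a| * algnorm x;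
  algnormM : forall x y, algnorm (x * y) <= algnorm x * algnorm y;
  algnorm1 : algnorm 1 = 1 }.

Section algebra_norm_theory.
Variables (R : realFieldType) (A : comAlgType R) (N : algebra_norm A).
Implicit Types (x y F G E : A) (a b c t q : R).

Lemma algnormN x : N (- x) = N x.
Proof. by rewrite -scaleN1r algnormZ normrN1 mul1r. Qed.

Lemma algnorm0 : N 0 = 0.
Proof. by rewrite -(scale0r (0 : A)) algnormZ normr0 mul0r. Qed.

Lemma algnorm_ge0 x : 0 <= N x.
Proof.
have := algnormD N x (- x); rewrite subrr algnorm0 algnormN -mulr2n pmulrn_lge0//.
Qed.

Lemma algnormB x y : N (x - y) <= N x + N y.
Proof. by rewrite -[N y]algnormN; exact: algnormD. Qed.

Lemma algnorm_sum (I : Type) (s : seq I) (P : pred I) (f : I -> A) :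
  N (\sum_(i <- s | P i) f i) <= \sum_(i <- s | P i) N (f i).
Proof.
elim/big_rec2: _ => [|i y1 y2 _ h]; first by rewrite algnorm0.
by apply: le_trans (algnormD _ _ _) _; rewrite lerD2l.
Qed.

Lemma algnorm_scalar a : N a%:A = `|a|.
Proof. by rewrite algnormZ algnorm1 mulr1. Qed.

Lemma algnorm_le_mul x y a b : N x <= a -> N y <= b -> N (x * y) <= a * b.
Proof. by move=> xa yb; apply: le_trans (algnormM _ _ _) _; rewrite ler_pM// algnorm_ge0. Qed.

Lemma algnorm_le_exp x a n : N x <= a -> N (x ^+ n) <= a ^+ n.
Proof.
move=> xa; elim: n => [|n IH]; first by rewrite !expr0 algnorm1.
by rewrite !exprS algnorm_le_mul.
Qed.

Lemma algnorm_exp_le1 x n : N x <= 1 -> N (x ^+ n) <= 1.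
Proof. by move=> /(algnorm_le_exp n); rewrite expr1n. Qed.

Lemma algnorm_horner G (P : {poly R}) m : N G <= 1 -> (size P <= m)%N ->
  N (horner_alg G P) <= \sum_(j < m) `|P`_j|.
Proof.
move=> G1 Pm; rewrite /horner_alg /horner_morph (@horner_coef_wide _ m); last first.
  by rewrite (leq_trans (size_poly _ _)).
apply: le_trans (algnorm_sum _ _ _) _; apply: ler_sum => j _.
rewrite coef_map /= mulr_algl algnormZ -[leRHS]mulr1 ler_wpM2l//.
exact: algnorm_exp_le1.
Qed.

(** The element is [krawtchouk t r L] evaluated at the contraction G, so its norm is at most the sum
    of the absolute values of the coefficients. *)
Lemma algnorm_krawtchouk_sqr_le G t r L : 0 < t < 1 -> N G <= 1 ->
  N ((G - 1) ^+ r * (1 + t *: (G - 1)) ^+ L) ^+ 2 <=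
  ('C(r + L, r)%:R * (t * (1 - t)) ^+ r)^-1.
Proof.
move=> t01 G1; apply: le_trans (sum_krawtchouk_coef_sqr_le t01 r L).
rewrite lerXn2r ?nnegrE ?algnorm_ge0 ?sumr_ge0//.
apply: le_trans (algnorm_horner G1 (size_krawtchouk t r L)).
rewrite le_eqVlt; apply/orP; left; apply/eqP; congr (N _).
rewrite /krawtchouk rmorphM /= !rmorphXn /= rmorphB rmorphD /= rmorph1 linearZ /=.
rewrite horner_algX horner_algC; congr (_ * _ ^+ L).
by rewrite mulr_algl scalerBr scalerBl scale1r; ring.
Qed.

(** The Krawtchouk bound for t = 1 / 2 and r = 1: a first difference of i lazy steps gains the
    square root of i + 1. *)
Lemma algnorm_diff_lazy_step E i : N E <= 1 ->
  N ((E - 1) * (2^-1 *: (1 + E)) ^+ i) ^+ 2 <= 4 / i.+1%:R.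
Proof.
move=> E1; have := @algnorm_krawtchouk_sqr_le E 2^-1 1 i _ E1.
rewrite expr1 add1n bin1; have -> : 1 + 2^-1 *: (E - 1) = 2^-1 *: (1 + E).
  have e : (1 : A) = 2^-1 *: 1 + 2^-1 *: 1.
    by rewrite -scalerDl (_ : 2^-1 + 2^-1 = 1) ?scale1r//; lra.
  rewrite [X in X + _ = _]e scalerBr scalerDr; ring.
have h : 2^-1 * (1 - 2^-1) = 4^-1 :> R by lra.
rewrite h expr1 invfM invrK [_^-1 * 4]mulrC; apply; apply/andP; split; lra.
Qed.

(* [P] dominates [4 b] times the lazy step [(1 + E) (1 + E') / 4]; a binomial
   number of the [a] steps are lazy, and the second difference of [i] lazy steps
   has norm at most [4 / (i + 1)]. *)
Lemma algnorm_second_diff_pow_le (E E' P : A) b (a : nat) :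
  E * E' = 1 -> N E <= 1 -> N E' <= 1 ->
  0 < b -> N (P - b *: (2%:R + E + E')) <= 1 - 4 * b ->
  N ((E + E' - 2%:R) * P ^+ a) <= (a.+1%:R * b)^-1.
Proof.
move=> EE E1 E'1 b0 Ps; pose s := 4 * b; pose U := 4^-1 *: (2%:R + E + E').
have s1 : 0 <= 1 - s by apply: le_trans Ps; exact: algnorm_ge0.
have PE : P = (P - s *: U) + s *: U by rewrite subrK.
have NR : N (P - s *: U) <= 1 - s by rewrite /U scalerA (_ : s * 4^-1 = b)// /s; field.
have UE : U = (2^-1 *: (1 + E)) * (2^-1 *: (1 + E')).
  rewrite -scalerAr -scalerAl scalerA /U; congr (_ *: _); first by field.
  rewrite mulrDl !mulrDr EE; ring.
have NU i : N ((E + E' - 2%:R) * U ^+ i) <= 4 / i.+1%:R.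
  (* The second difference is -(E - 1)(E' - 1), and [U] splits in the same way; each first
     difference is smoothed by its own lazy steps. *)
  have -> : (E + E' - 2%:R) * U ^+ i = - (((E - 1) * (2^-1 *: (1 + E)) ^+ i) *
      ((E' - 1) * (2^-1 *: (1 + E')) ^+ i)).
    rewrite UE exprMn mulrACA -mulNr; congr (_ * _).
    by rewrite mulrBl !mulrBr EE; ring.
  rewrite algnormN -(@ler_pXn2r _ 2) ?nnegrE ?algnorm_ge0 ?divr_ge0//.
  apply: (@le_trans _ _ ((N ((E - 1) * (2^-1 *: (1 + E)) ^+ i) *
                        N ((E' - 1) * (2^-1 *: (1 + E')) ^+ i)) ^+ 2)).
    by rewrite lerXn2r ?nnegrE ?algnormM ?mulr_ge0 ?algnorm_ge0.
  by rewrite exprMn [leRHS]expr2 ler_pM ?sqr_ge0 ?algnorm_diff_lazy_step.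
have s0 : 0 < s by rewrite mulr_gt0.
apply: (@le_trans _ _ (\sum_(i < a.+1) 'C(a, i)%:R * (1 - s) ^+ (a - i) * s ^+ i *
    (4 / i.+1%:R))).
  rewrite [X in X ^+ a]PE exprDn mulr_sumr.
  apply: le_trans (algnorm_sum _ _ _) _; apply: ler_sum => i _.
  rewrite mulrnAr -[_ *+ 'C(a, i)]scaler_nat algnormZ normr_nat -!mulrA ler_wpM2l ?ler0n//.
  have -> : (E + E' - 2%:R) * ((P - s *: U) ^+ (a - i) * (s *: U) ^+ i) =
      s ^+ i *: ((P - s *: U) ^+ (a - i) * ((E + E' - 2%:R) * U ^+ i)).
    by rewrite exprZn -!scalerAr; congr (_ *: _); ring.
  have si : 0 <= s ^+ i by rewrite exprn_ge0// ltW.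
  rewrite algnormZ ger0_norm// [leRHS]mulrCA ler_wpM2l//.
  by rewrite algnorm_le_mul// algnorm_le_exp.
(* Absorption, C(a, i) / (i + 1) = C(a + 1, i + 1) / (a + 1), leaves the expansion of (1 - s + s)^(a
   + 1) without its term of index 0. *)
have -> : \sum_(i < a.+1) 'C(a, i)%:R * (1 - s) ^+ (a - i) * s ^+ i * (4 / i.+1%:R) =
  (a.+1%:R * b)^-1 * \sum_(i < a.+1) (1 - s) ^+ (a.+1 - i.+1) * s ^+ i.+1 *+ 'C(a.+1, i.+1).
  rewrite mulr_sumr; apply: eq_bigr => i _; rewrite subSS.
  have h := congr1 (fun n => n%:R : R) (mul_bin_diag a.+1 i); rewrite /= !natrM in h.
  have -> : 'C(a, i)%:R = i.+1%:R * 'C(a.+1, i.+1)%:R / a.+1%:R :> R.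
    by rewrite -h mulrC mulKf// pnatr_eq0.
  rewrite -[_ *+ 'C(_, _)]mulr_natl /s exprS.
  have := pnatr_eq0 R a.+1 => /negbT; have := pnatr_eq0 R i.+1 => /negbT.
  move: (i.+1%:R : R) (a.+1%:R : R) => i' a' i0 a0.
  by field; rewrite i0 a0 gt_eqF.
rewrite -[leRHS]mulr1 ler_wpM2l// ?invr_ge0 ?mulr_ge0// ?(ltW b0)//.
have h : 1 = (1 - s + s) ^+ a.+1 by rewrite subrK expr1n.
rewrite [leRHS]h [leRHS]exprDn [leRHS]big_ord_recl.
by rewrite lerDr mulrn_wge0// mulr_ge0 ?exprn_ge0// (ltW s0).
Qed.
End algebra_norm_theory.

(** C(M + j, j) C(M, j) = C(2 j, j) C(M + j, 2 j), where C(M, j) <= C(M + j, j) and C(2 j, j) <=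
    4^j. This makes the terms of the perturbation series geometric. *)
Lemma bin_sqr_le_central M j : (j <= M)%N ->
  ('C(M, j) ^ 2 <= 4 ^ j * 'C(M + j, j.*2))%N.
Proof.
move=> jM; have c4 : ('C(j.*2, j) <= 4 ^ j)%N.
  have jl : (j < j.*2.+1)%N by lia.
  rewrite (_ : 4 = (1 + 1) ^ 2)%N// -expnM mul2n expnDn (bigD1 (Ordinal jl))//=.
  by rewrite !exp1n !muln1 leq_addr.
have h : ('C(M + j, j) * 'C(M, j) = 'C(j.*2, j) * 'C(M + j, j.*2))%N.
  apply/eqP; rewrite -(@eqn_pmul2r (j`! * j`! * (M - j)`!)) ?muln_gt0 ?fact_gt0//.
  apply/eqP.
  transitivity (M + j)`!%N.
    rewrite -(@bin_fact (M + j) j) ?leq_addl// addnK -[M`!](bin_fact jM); nia.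
  rewrite -(@bin_fact (M + j) j.*2); last lia.
  rewrite -[(j.*2)`!](@bin_fact _ j); last lia.
  rewrite (_ : M + j - j.*2 = M - j)%N; last lia.
  by rewrite (_ : j.*2 - j = j)%N; [nia|lia].
apply: leq_trans (_ : 'C(j.*2, j) * 'C(M + j, j.*2) <= _)%N.
  by rewrite -h expnS expn1 leq_mul2r leq_bin2l ?orbT ?leq_addr.
by rewrite leq_mul2r c4 orbT.
Qed.

(** * Quadratic perturbation of a binomial law *)

Section perturbation.
Variables (R : realFieldType) (A : comAlgType R) (N : algebra_norm A).

(* The threshold [2 c < t (1 - t)] is sharp, thanks to the exact value of the
   Krawtchouk norms. *)
Lemma algnorm_perturbed_lazy_pow_le (G : A) (t c : R) (M : nat) :
  0 < t < 1 -> N G <= 1 -> 0 <= c -> 2 * c < t * (1 - t) ->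
  N ((1 + t *: (G - 1) - c *: (G - 1) ^+ 2) ^+ M) <= (1 - 2 * c / (t * (1 - t)))^-1.
Proof.
move=> t01 G1 c0 ct; have t0 : 0 < t * (1 - t).
  by case/andP: t01 => ? ?; rewrite mulr_gt0// subr_gt0.
set rho := 2 * c / _.
have rho0 : 0 <= rho by rewrite divr_ge0 ?(ltW t0)// mulr_ge0.
have rho1 : rho < 1 by rewrite ltr_pdivrMr// mul1r.
apply: (@le_trans _ _ (\sum_(j < M.+1) rho ^+ j)); last first.
  rewrite -[leRHS]mul1r ler_pdivlMr ?subr_gt0//.
  have := subrX1 rho M.+1; set S := \sum_(_ < _) _ => h.
  have : 0 <= rho ^+ M.+1 by rewrite exprn_ge0.
  have -> : S * (1 - rho) = 1 - rho ^+ M.+1 by rewrite -[RHS]opprB h; ring.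
  by rewrite lerBlDr lerDl.
rewrite exprDn; apply: le_trans (algnorm_sum _ _ _ _) _; apply: ler_sum => -[j /= jM] _.
rewrite ltnS in jM.
set x := 1 + _; set v := G - 1.
(* The j-th term is a Krawtchouk element with r = 2 j and L = M - j, hence of order r + L = M +
   j. *)
have -> : x ^+ (M - j) * (- (c *: v ^+ 2)) ^+ j *+ 'C(M, j) =
    ('C(M, j)%:R * (- c) ^+ j) *: (v ^+ j.*2 * x ^+ (M - j)).
  rewrite -scaleNr exprZn -exprM mul2n -[_ *+ 'C(M, j)]scaler_nat -scalerAr scalerA.
  by rewrite [x ^+ _ * _]mulrC.
rewrite algnormZ normrM normr_nat normrX normrN ger0_norm//.
rewrite -(@ler_pXn2r _ 2) ?nnegrE ?exprn_ge0 ?mulr_ge0 ?exprn_ge0 ?algnorm_ge0//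
  ?invr_ge0 ?(ltW t0)//.
have := algnorm_krawtchouk_sqr_le j.*2 (M - j) t01 G1; rewrite -/v -/x => h.
rewrite exprMn; apply: le_trans (ler_wpM2l (sqr_ge0 _) h) _.
have -> : (j.*2 + (M - j) = M + j)%N by lia.
have C0 : 0 < 'C(M + j, j.*2)%:R :> R by rewrite ltr0n bin_gt0; lia.
rewrite ler_pdivrMr ?mulr_gt0 ?exprn_gt0//.
have -> : (rho ^+ j) ^+ 2 * ('C(M + j, j.*2)%:R * (t * (1 - t)) ^+ j.*2) =
   (c ^+ j) ^+ 2 * (4 ^ j * 'C(M + j, j.*2))%:R.
  rewrite mulrCA natrM natrX [RHS]mulrA [RHS]mulrC; congr (_ * _).
  rewrite -muln2 exprM -!exprMn /rho divfK ?gt_eqF// !exprMn mulrC; congr (_ * _).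
  by rewrite -exprM mulnC exprM; congr (_ ^+ _); rewrite -natrX.
by rewrite exprMn mulrC ler_wpM2l ?sqr_ge0// -natrX ler_nat bin_sqr_le_central.
Qed.

End perturbation.

(** * Smoothing *)

(* [F] stands for [q%:A + \sum_x p x *: E x], where [E x] is the shift by [x] and
   [E' x] its inverse; [Delta] bounds [delta y], whose sum is over nonzero [x]. *)
Record symmetric_element (R : realFieldType) (A : comAlgType R) (N : algebra_norm A)
  (I : Type) (p : I -> R) (E E' : I -> A) (F : A) (q y Delta : R) : Prop :=
SymmetricElement {
  atom01 : 0 < q < 1;
  prob_ge0 : forall i, 0 <= p i;
  shiftK : forall i, E i * E' i = 1;
  shift_le1 : forall i, N (E i) <= 1;
  shiftV_le1 : forall i, N (E' i) <= 1;
  distr_le1 : N F <= 1;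
  distr_atom : N (F - q%:A) <= 1 - q;
  distr_part : forall i a b, 0 <= a <= q -> 0 <= b <= p i ->
    N (F - (a%:A + b *: (E i + E' i))) <= 1 - (a + 2 * b);
  distr_approx : forall e, 0 < e -> exists2 s : seq I,
    N (F - 1 - \sum_(i <- s) (p i / 2) *: (E i + E' i - 2%:R)) <= e &
    \sum_(i <- s) Num.min 1 (4 * y * p i) <= Delta }.

Section smoothing.
Variables (R : realFieldType) (A : comAlgType R) (N : algebra_norm A).
Variables (I : Type) (p : I -> R) (E E' : I -> A) (F : A) (q y Delta : R).
Hypothesis HF : symmetric_element N p E E' F q y Delta.
Hypothesis y0 : 0 < y.

Let w := F - 1.

Let q0 : 0 < q. Proof. by case/andP: (atom01 HF). Qed.
Let q1 : q < 1. Proof. by case/andP: (atom01 HF). Qed.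

(** The atom at x is matched by one at -x: [distr_part] with a = 0 makes 1 - 2 p_x an upper bound
    for a norm. *)
Lemma prob_le_half i : p i <= 2^-1.
Proof.
have := distr_part HF (i := i) (a := 0) (b := p i).
rewrite !lexx (ltW q0) (prob_ge0 HF) => /(_ isT isT) h.
by have := le_trans (algnorm_ge0 N _) h; lra.
Qed.

(** Reduces the smoothing of w to one pair of atoms at a time: up to e, w is a finite half-sum of
    weighted second differences, and each of these is compared with its own term of [Delta]. *)
Lemma centered_mul_le (Y : A) (kappa : R) : 1 <= kappa -> N Y <= 1 ->
  (forall i, 0 < p i -> p i * N ((E i + E' i - 2%:R) * Y) <= 2 * kappa / y) ->
  N (w * Y) <= kappa * Delta / y.
Proof.
move=> k1 Y1 H; apply/ler_addgt0Pr => e e0.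
have [s hs Ds] := distr_approx HF e0.
set S := \sum_(i <- s) _ in hs.
have -> : w * Y = S * Y + (F - 1 - S) * Y by rewrite -mulrDl addrC subrK.
apply: le_trans (algnormD _ _ _) _; apply: lerD; last first.
  by rewrite -[e]mulr1 algnorm_le_mul.
rewrite mulr_suml; apply: le_trans (algnorm_sum _ _ _ _) _.
rewrite mulrAC; apply: le_trans (ler_wpM2l _ Ds); last first.
  by rewrite divr_ge0 ?(ltW y0)//; lra.
rewrite mulr_sumr; apply: ler_sum => i _.
rewrite -scalerAl algnormZ ger0_norm ?divr_ge0 ?(prob_ge0 HF)//.
have pi0 := prob_ge0 HF i.
have NV : N (E i + E' i - 2%:R) <= 4.
  apply: le_trans (algnormB _ _ _) _.
  have -> : N 2%:R = 2 by rewrite -scaler_nat algnorm_scalar normr_nat.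
  have := algnormD N (E i) (E' i); have := shift_le1 HF i; have := shiftV_le1 HF i; lra.
have NVY : N ((E i + E' i - 2%:R) * Y) <= 4 by rewrite -[4]mulr1 algnorm_le_mul.
have ky : kappa / y * y = kappa by rewrite divfK ?gt_eqF.
(* Where the minimum is 1 the smoothing hypothesis is used; elsewhere the trivial bound 4 on the
   second difference suffices, as kappa >= 1. *)
rewrite /Num.min; case: ifP => _.
  rewrite mulr1; have [p0|] := ltP 0 (p i); first by have := H i p0; lra.
  move=> p0; have -> : p i = 0 by apply/eqP; rewrite eq_le p0 pi0.
  by rewrite !mul0r divr_ge0 ?(ltW y0)//; lra.
apply: (@le_trans _ _ (2 * p i)).
  have : p i * N ((E i + E' i - 2%:R) * Y) <= p i * 4 by rewrite ler_wpM2l.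
  lra.
rewrite [leRHS](_ : _ = (kappa / y * y) * 4 * p i); last by ring.
by rewrite ky ler_wpM2r//; lra.
Qed.

(** F dominates b (2 I + E_x + E_-x) as soon as 2 b <= q and b <= p_x. The choice is b = p_x for
    light atoms and b = q / 2 for heavy ones, where p_x <= 1 / 2 compensates. *)
Lemma centered_distr_pow_le kappa a : 1 <= kappa -> y <= kappa * a.+1%:R * q ->
  N (w * F ^+ a) <= kappa * Delta / y.
Proof.
move=> k1 ya; apply: centered_mul_le => // [|i p0].
  exact: algnorm_exp_le1 (distr_le1 HF).
have a0 : 0 < a.+1%:R :> R by rewrite ltr0n.
have main b : 0 < b -> 2 * b <= q -> b <= p i ->
    N ((E i + E' i - 2%:R) * F ^+ a) <= (a.+1%:R * b)^-1.
  move=> b0 bq bp; apply: algnorm_second_diff_pow_le => //.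
  - exact: (shiftK HF).
  - exact: (shift_le1 HF).
  - exact: (shiftV_le1 HF).
  have -> : b *: (2%:R + E i + E' i) = (2 * b)%:A + b *: (E i + E' i).
    by rewrite -addrA scalerDr -[2%:R in LHS]scaler_nat scalerA mulrC.
  have := distr_part HF (i := i) (a := 2 * b) (b := b).
  rewrite bq bp (ltW b0) mulr_ge0 ?(ltW b0)// => /(_ isT isT); lra.
have pa : (a.+1%:R * q)^-1 <= kappa / y.
  by rewrite ler_pdivlMr// mulrC ler_pdivrMr ?mulr_gt0// mulrA.
have ha := prob_le_half i.
have [pq|qp] := leP (2 * p i) q.
  apply: le_trans (ler_wpM2l (ltW p0) (main _ p0 pq (lexx _))) _.
  rewrite invfM mulrCA mulfV ?gt_eqF// mulr1.
  have h1 : a.+1%:R^-1 <= (a.+1%:R * q)^-1.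
    by rewrite lef_pV2 ?posrE ?mulr_gt0// ger_pMr// ltW.
  have h2 : 0 <= (a.+1%:R * q)^-1 by rewrite invr_ge0 mulr_ge0// ltW.
  rewrite -[leRHS]mulrA; move: (_ * q)^-1 (kappa / y) a.+1%:R^-1 pa h1 h2 => z z' u *; lra.
have hb : N ((E i + E' i - 2%:R) * F ^+ a) <= (a.+1%:R * (q / 2))^-1.
  by apply: main; have := q0; lra.
apply: le_trans (ler_wpM2l (ltW p0) hb) _.
have -> : (a.+1%:R * (q / 2))^-1 = 2 * (a.+1%:R * q)^-1.
  by rewrite invfM invf_div mulrCA -invfM.
have z0 : 0 <= (a.+1%:R * q)^-1 by rewrite invr_ge0 mulr_ge0// ltW.
rewrite -[leRHS]mulrA; move: (_ * q)^-1 (kappa / y) pa z0 => z z' zz z0.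
have : p i * (2 * z) <= 2^-1 * (2 * z) by rewrite ler_wpM2r//; lra.
lra.
Qed.

Lemma lazy_distr_le1 (eta : R) : 0 <= eta <= 1 -> N (1 + eta *: w) <= 1.
Proof.
move=> eta01; have -> : 1 + eta *: w = (1 - eta)%:A + eta *: F.
  by rewrite /w scalerBr scalerBl scale1r; ring.
apply: le_trans (algnormD _ _ _) _; rewrite algnorm_scalar algnormZ.
rewrite !ger0_norm; [|lra|lra].
have : eta * N F <= eta * 1 by rewrite ler_wpM2l ?(distr_le1 HF)//; lra.
lra.
Qed.

(** For small eta the mass 1 - eta at the origin always covers 2 eta p_x, so b = eta p_x is
    admissible for every x and p_x cancels from the bound. *)
Lemma centered_lazy_pow_le kappa (eta : R) a : 1 <= kappa -> 0 < eta <= 3^-1 ->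
  y <= 2 * kappa * a.+1%:R * eta ->
  N (w * (1 + eta *: w) ^+ a) <= kappa * Delta / y.
Proof.
move=> k1 /andP[eta0 eta3] ya; apply: centered_mul_le => // [|i p0].
  by apply: algnorm_exp_le1; apply: lazy_distr_le1; lra.
have a0 : 0 < a.+1%:R :> R by rewrite ltr0n.
have hp := prob_le_half i.
have h : N ((E i + E' i - 2%:R) * (1 + eta *: w) ^+ a) <= (a.+1%:R * (eta * p i))^-1.
  have ep0 : 0 < eta * p i by rewrite mulr_gt0.
  have ep1 : eta * p i <= 3^-1 * 2^-1 by rewrite ler_pM// ltW.
  apply: algnorm_second_diff_pow_le => //.
  - exact: (shiftK HF).
  - exact: (shift_le1 HF).
  - exact: (shiftV_le1 HF).
  have -> : 1 + eta *: w - (eta * p i) *: (2%:R + E i + E' i) =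
     (1 - eta - 2 * (eta * p i))%:A + eta *: (F - (0%:A + p i *: (E i + E' i))).
    rewrite /w -[2%:R + _ + _]addrA [_ *: (2%:R + _)]scalerDr -[2%:R in LHS]scaler_nat scalerA.
    rewrite !scalerBr scale0r add0r scalerA !scalerBl scale1r [eta * p i * _]mulrC; ring.
  apply: le_trans (algnormD _ _ _) _; rewrite algnorm_scalar algnormZ.
  have := distr_part HF (i := i) (a := 0) (b := p i).
  rewrite !lexx (ltW q0) (prob_ge0 HF) => /(_ isT isT) h.
  have := ler_wpM2l (ltW eta0) h; rewrite !ger0_norm; lra.
apply: le_trans (ler_wpM2l (ltW p0) h) _.
have -> : p i * (a.+1%:R * (eta * p i))^-1 = (a.+1%:R * eta)^-1.
  by rewrite mulrA [in LHS]invfM mulrCA mulfV ?gt_eqF// mulr1.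
by rewrite ler_pdivlMr// mulrC ler_pdivrMr ?mulr_gt0// mulrA.
Qed.

(** [Y ^+ m] is cut into l blocks [Y ^+ a], one for each factor w; what is left over is a
    contraction. *)
Lemma centered_pow_le (Y : A) (B : R) a l m : N Y <= 1 -> N (w * Y ^+ a) <= B ->
  (l * a <= m)%N -> N (w ^+ l * Y ^+ m) <= B ^+ l.
Proof.
move=> Y1 YB /subnK <-.
have -> : w ^+ l * Y ^+ (m - l * a + l * a) = (w * Y ^+ a) ^+ l * Y ^+ (m - l * a).
  by rewrite exprD mulrCA mulrC -mulrA exprMn -exprM [(a * l)%N]mulnC; ring.
by rewrite -[leRHS]mulr1 algnorm_le_mul ?algnorm_le_exp ?algnorm_exp_le1.
Qed.

(** One m-th of the exponent w - w^2 / 2: this factor carries the reserve q w / 2 and the next one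
    the rest. The product of the two is 1 + (w - w^2 / 2) / m up to order 1 / m^2. *)
Definition lazy_factor (m : nat) : A := 1 + (q / (2 * m%:R)) *: w.
Definition bounded_factor (m : nat) : A :=
  1 + m%:R^-1 *: ((1 - q / 2) *: w - 2^-1 *: w ^+ 2).

(** In powers of G - 1 this is a perturbed lazy step, with ratio (1 - q) / ((1 - q / 2) (1 - t)).
    The hypothesis on m gives t <= q / 4 and keeps the ratio below 1 - q / 4. The bound is free of
    M, which will be m b. *)
Lemma bounded_factor_pow_le m M : 4 <= m%:R * q ->
  N (bounded_factor m ^+ M) <= 4 / q.
Proof.
move=> mq; have m0 : 0 < m%:R :> R.
  by rewrite -(pmulr_lgt0 _ q0); lra.
have p0 : 0 < 1 - q by rewrite subr_gt0.
set G := (1 - q)^-1 *: (F - q%:A).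
have G1 : N G <= 1.
  rewrite algnormZ ger0_norm ?invr_ge0 ?(ltW p0)// mulrC ler_pdivrMr// mul1r.
  exact: (distr_atom HF).
have Gw : G - 1 = (1 - q)^-1 *: w.
  have {1}-> : 1 = (1 - q)^-1 *: (1 - q)%:A :> A by rewrite scalerA mulVf ?gt_eqF// scale1r.
  by rewrite -scalerBr; congr (_ *: _); rewrite /w scalerBl scale1r; ring.
pose t := (1 - q / 2) * (1 - q) / m%:R; pose c := (1 - q) ^+ 2 / (2 * m%:R).
have -> : bounded_factor m = 1 + t *: (G - 1) - c *: (G - 1) ^+ 2.
  rewrite Gw exprZn !scalerA /bounded_factor scalerBr !scalerA addrA.
  congr (1 + _ *: w - _ *: _).
    by rewrite /t; field; rewrite (gt_eqF m0) (gt_eqF p0).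
  by rewrite /c; field; rewrite (gt_eqF m0) (gt_eqF p0).
have mV : m%:R^-1 <= q / 4 by rewrite -[leLHS]mul1r ler_pdivrMr//; lra.
have mV0 : 0 < m%:R^-1 :> R by rewrite invr_gt0.
have tq : 0 < t <= q / 4.
  have h1 : (1 - q / 2) * (1 - q) <= 1 by have := q0; have := q1; nra.
  have h0 : 0 < (1 - q / 2) * (1 - q) by rewrite mulr_gt0//; have := q1; lra.
  by rewrite mulr_gt0//= (le_trans _ mV)// ger_pMl.
have t1 : t < 1 by case/andP: tq => _; have := q1; lra.
have t0 : 0 < t by case/andP: tq.
have r4 : 2 * c / (t * (1 - t)) <= 1 - q / 4.
  have -> : 2 * c / (t * (1 - t)) = (1 - q) / ((1 - q / 2) * (1 - t)).
    rewrite {1}/t /c; field.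
    rewrite (gt_eqF m0) (gt_eqF p0) gt_eqF ?gt_eqF//; have := q1; lra.
  have t2 : 1 - q / 4 <= 1 - t by case/andP: tq => _; lra.
  have q2 : 0 < 1 - q / 2 by have := q1; lra.
  have t3 : 0 < 1 - t by rewrite subr_gt0.
  rewrite ler_pdivrMr ?mulr_gt0//.
  have : (1 - q / 2) * (1 - q / 4) <= (1 - q / 2) * (1 - t) by rewrite ler_wpM2l// ltW.
  have := q0; have := q1; nra.
have tt : 0 < t * (1 - t) by apply: mulr_gt0 t0 _; rewrite subr_gt0.
apply: le_trans (algnorm_perturbed_lazy_pow_le M _ G1 _ _) _; rewrite ?t0 ?t1//.
- by rewrite divr_ge0 ?sqr_ge0// mulr_ge0 ?(ltW m0).
- rewrite -[ltRHS]mul1r -ltr_pdivrMr//.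
  by apply: le_lt_trans r4 _; have := q0; lra.
rewrite -[leRHS]invrK lef_pV2 ?posrE ?invf_div; [|have := q0; lra|have := q0; lra].
by have := r4; lra.
Qed.

End smoothing.

(** * Approximation of the exponential *)

Lemma leq_ffact_exp m j : (m ^_ j <= m ^ j)%N.
Proof. by elim: j => // j IH; rewrite ffactnSr expnSr leq_mul// leq_subr. Qed.

Lemma leq_bin_exp m j : ('C(m, j) <= m ^ j)%N.
Proof.
by apply: leq_trans (leq_ffact_exp m j); rewrite -bin_ffact leq_pmulr// fact_gt0.
Qed.

(** * Convergence in norm *)

Section algebra_limits.
Variables (R : realType) (A : comAlgType R) (N : algebra_norm A).

(** The algebra carries no topology, so convergence is stated through a real sequence. *)
Definition alg_cvg (u : nat -> A) (l : A) := (fun n => N (u n - l)) @ \oo --> (0 : R).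

Lemma alg_cvg_le (u : nat -> A) (l : A) (v : nat -> R) :
  (forall n, N (u n - l) <= v n) -> v @ \oo --> (0 : R) -> alg_cvg u l.
Proof.
move=> uv v0; apply: (@squeeze_cvgr _ _ _ _ (cst 0) v) => //; last exact: cvg_cst.
by apply: nearW => n /=; rewrite algnorm_ge0 uv.
Qed.

Lemma alg_cvg_cst (l : A) : alg_cvg (fun=> l) l.
Proof.
by apply: (@alg_cvg_le _ _ (cst 0)) => [n|]; [rewrite subrr algnorm0|exact: cvg_cst].
Qed.

Lemma alg_cvgM (u v : nat -> A) (l m : A) : alg_cvg u l -> alg_cvg v m ->
  alg_cvg (fun n => u n * v n) (l * m).
Proof.
move=> ul vm; apply: (@alg_cvg_le _ _
  (fun n => N (u n - l) * (N (v n - m) + N m) + N l * N (v n - m))) => [n|].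
  have -> : u n * v n - l * m = (u n - l) * ((v n - m) + m) + l * (v n - m) by ring.
  apply: le_trans (algnormD _ _ _) _; apply: lerD; last exact: algnormM.
  by apply: algnorm_le_mul => //; exact: algnormD.
have h : (fun n => N (v n - m) + N m) @ \oo --> 0 + N m.
  by apply: cvgD => //; exact: cvg_cst.
have h1 : (fun n => N (u n - l) * (N (v n - m) + N m)) @ \oo --> 0 * (0 + N m).
  exact: cvgM ul h.
have h2 : (fun n => N l * N (v n - m)) @ \oo --> N l * 0.
  by apply: cvgM => //; exact: cvg_cst.
have := cvgD h1 h2; rewrite mul0r mulr0 addr0; exact.
Qed.

Lemma alg_cvgD (u v : nat -> A) (l m : A) : alg_cvg u l -> alg_cvg v m ->
  alg_cvg (fun n => u n + v n) (l + m).
Proof.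
move=> ul vm; apply: (@alg_cvg_le _ _ (fun n => N (u n - l) + N (v n - m))) => [n|].
  by rewrite (_ : _ + _ - _ = (u n - l) + (v n - m)) ?algnormD//; ring.
have := cvgD ul vm; rewrite addr0; exact.
Qed.

Lemma alg_cvgN (u : nat -> A) (l : A) : alg_cvg u l -> alg_cvg (fun n => - u n) (- l).
Proof.
move=> ul; apply: (@alg_cvg_le _ _ (fun n => N (u n - l))) => // n.
by rewrite -opprD algnormN.
Qed.

Lemma alg_cvgX (u : nat -> A) (l : A) i : alg_cvg u l ->
  alg_cvg (fun n => u n ^+ i) (l ^+ i).
Proof.
move=> ul; elim: i => [|i IH]; first exact: alg_cvg_cst.
under [X in alg_cvg X]eq_fun => n do rewrite exprS.
by rewrite exprS; exact: alg_cvgM.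
Qed.

Lemma alg_cvg_norm_le (u : nat -> A) (l : A) (c : R) : alg_cvg u l ->
  (\forall n \near \oo, N (u n) <= c) -> N l <= c.
Proof.
move=> ul uc; apply/ler_addgt0Pr => e e0.
have /cvgr0Pnorm_lt /(_ _ e0) ue := ul.
near \oo => n.
have -> : l = u n - (u n - l) by ring.
apply: le_trans (algnormB _ _ _) _; apply: lerD; first by near: n.
apply: ltW; rewrite -[ltLHS]ger0_norm ?algnorm_ge0//; near: n; exact: ue.
Unshelve. all: by end_near. Qed.

End algebra_limits.

(** * Powers of 1 + u / m against partial sums of the exponential *)

Section exponential_approximation.
Variables (R : realType) (A : comAlgType R) (N : algebra_norm A).
Implicit Types (u r w x : A).

Definition exp_partial (x : A) (J : nat) : A := \sum_(j < J) j`!%:R^-1 *: x ^+ j.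

Lemma exp_partial_sum_le (x : R) J : 0 <= x -> \sum_(j < J) j`!%:R^-1 * x ^+ j <= expR x.
Proof.
move=> x0; rewrite (_ : \sum_(j < J) _ = series (exp_coeff x) J); last first.
  by rewrite seriesEord; apply: eq_bigr => j _; rewrite /exp_coeff mulrC.
apply: nondecreasing_cvgn_le; last exact: is_cvg_series_exp_coeff.
by apply: nondecreasing_series => n _ _; exact: exp_coeff_ge0.
Qed.

Lemma expr_1Ddiv_le (x : R) m : 0 <= x -> (1 + x / m%:R) ^+ m <= expR x.
Proof.
case: m => [|m] x0; first by rewrite expr0 -expR0 ler_expR.
have m0 : m.+1%:R != 0 :> R by rewrite pnatr_eq0.
have -> : expR x = expR (x / m.+1%:R) ^+ m.+1 by rewrite -expRM_natl mulrC divfK.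
by rewrite lerXn2r ?nnegrE ?expR_ge0 ?expR_ge1Dx// addr_ge0// divr_ge0.
Qed.

Lemma algnorm_subX_le x u (c : R) m : 0 <= c -> N x <= c -> N u <= c ->
  N (x ^+ m - u ^+ m) <= m%:R * N (x - u) * c ^+ m.-1.
Proof.
move=> c0 xc uc; rewrite [m%:R * _]mulrC -mulrA subrXX; apply: algnorm_le_mul => //.
apply: le_trans (algnorm_sum _ _ _ _) _.
have -> : m%:R * c ^+ m.-1 = \sum_(i < m) c ^+ m.-1 by rewrite sumr_const card_ord mulr_natl.
apply: ler_sum => -[i /= im] _.
have h : m.-1 = (m.-1 - i + i)%N by lia.
rewrite [X in _ <= c ^+ X]h exprD.
by apply: algnorm_le_mul; exact: algnorm_le_exp.
Qed.

Lemma ffact_ratio_le1 (m j : nat) : (0 < m)%N -> (m ^_ j)%:R / m%:R ^+ j <= 1 :> R.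
Proof.
move=> m0; rewrite ler_pdivrMr ?exprn_gt0 ?ltr0n// mul1r -natrX ler_nat.
exact: leq_ffact_exp.
Qed.

(** The ratio is the product of the 1 - i / m over i < j, so the j-th step loses at most j / m. *)
Lemma ffact_ratio_ge (m j : nat) : (0 < m)%N ->
  1 - (j ^ 2)%:R / m%:R <= (m ^_ j)%:R / m%:R ^+ j :> R.
Proof.
move=> m0; have m0' : 0 < m%:R :> R by rewrite ltr0n.
elim: j => [|j IH]; first by rewrite ffactn0 expr0 mul0r subr0 divr1.
have [mj|jm] := ltnP m j.+1.
  apply: (@le_trans _ _ 0); last by rewrite divr_ge0// exprn_ge0// ltW.
  rewrite subr_le0 ler_pdivlMr// mul1r ler_nat; nia.
rewrite ffactnSr natrM natrB; last lia.
rewrite exprSr invfM mulrACA mulrBl mulfV ?gt_eqF//.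
have f1 := ffact_ratio_le1 j m0.
have j0 : 0 <= j%:R / m%:R :> R by rewrite divr_ge0.
have -> : (j.+1 ^ 2)%:R / m%:R = (j ^ 2)%:R / m%:R + 2 * (j%:R / m%:R) + m%:R^-1 :> R.
  have -> : (j.+1 ^ 2)%:R = (j ^ 2)%:R + 2 * j%:R + 1 :> R by rewrite natrX -natr1 natrX; ring.
  by move: m%:R^-1 (j%:R : R) => z v; rewrite natrX; ring.
have : 0 <= m%:R^-1 :> R by rewrite invr_ge0 ltW.
move: ((m ^_ j)%:R / m%:R ^+ j : R) (j%:R / m%:R : R) ((j ^ 2)%:R / m%:R : R)
  IH f1 j0 => f z s IH f1 z0 v0.
have : f * z <= 1 * z by rewrite ler_wpM2r.
lra.
Qed.

(** The coefficients of u^j differ by at most j^2 / (m j!). Since j^2 <= 4^j and u^j has norm at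
    most 4^j, the total is dominated by the series of exp 16. *)
Lemma algnorm_pow_sub_exp_partial_le u m : (0 < m)%N -> N u <= 4 ->
  N ((1 + m%:R^-1 *: u) ^+ m - exp_partial u m.+1) <= expR 16 / m%:R.
Proof.
move=> m0 u4; have m0' : 0 < m%:R :> R by rewrite ltr0n.
rewrite exprDn /exp_partial -sumrB.
apply: le_trans (algnorm_sum _ _ _ _) _.
apply: (@le_trans _ _ (\sum_(j < m.+1) j`!%:R^-1 * 16 ^+ j / m%:R)); last first.
  by rewrite -mulr_suml ler_wpM2r ?invr_ge0 ?(ltW m0')//; exact: exp_partial_sum_le.
apply: ler_sum => -[j /= jm] _.
have f0 : j`!%:R != 0 :> R by rewrite pnatr_eq0 -lt0n fact_gt0.
rewrite expr1n mul1r exprZn -[_ *+ 'C(m, j)]scaler_nat scalerA -scalerBl algnormZ.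
have -> : 'C(m, j)%:R * m%:R^-1 ^+ j - j`!%:R^-1 =
    - (j`!%:R^-1 * (1 - (m ^_ j)%:R / m%:R ^+ j)) :> R.
  rewrite -bin_ffact natrM exprVn mulrBr mulr1 opprB; congr (_ - _).
  by rewrite [_ * j`!%:R]mulrC mulrA mulKf.
have h := ffact_ratio_ge j m0.
have f1 := ffact_ratio_le1 j m0.
rewrite normrN normrM ger0_norm ?invr_ge0// ger0_norm ?subr_ge0//.
rewrite -!mulrA ler_wpM2l ?invr_ge0//.
have -> : 16 ^+ j / m%:R = ((4 ^ j)%:R / m%:R) * 4 ^+ j :> R.
  by rewrite mulrAC natrX -exprMn; congr (_ ^+ _ / _); rewrite -natrM.
apply: ler_pM; rewrite ?subr_ge0 ?algnorm_ge0 ?algnorm_le_exp//.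
have j4 : (j ^ 2 <= 4 ^ j)%N.
  by rewrite (_ : 4 = 2 ^ 2)%N// -expnM mulnC expnM leq_exp2r// ltnW// ltn_expl.
have : (j ^ 2)%:R / m%:R <= (4 ^ j)%:R / m%:R :> R.
  by rewrite ler_wpM2r ?invr_ge0 ?(ltW m0')// ler_nat.
lra.
Qed.

End exponential_approximation.

(** * The expansion in a normed algebra *)

Section expansion_remainder.
Variables (R : realType) (A : comAlgType R) (N : algebra_norm A).

(** w - w^2 / 2 is the logarithm of 1 + w to second order. With u = w (1 - w / 2), the terms of
    degree at most 2 in u leave w^3 (1 / 2 - w / 8), and all others contain u^3 = w^3 (1 - w / 2)^3.
    [H] depends on the truncation, but its bound does not. *)
Lemma exp_partial_third_order (w : A) J : N w <= 2 -> exists2 H : A,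
  1 + w - exp_partial (w - 2^-1 *: w ^+ 2) J.+3 = w ^+ 3 * H &
  N H <= 1 + 8 * expR 4.
Proof.
move=> w2; set h : A := 2^-1%:A; set u := w - _.
have hw x : 2^-1 *: x = h * x by rewrite /h mulr_algl.
have Nh : N h = 2^-1 by rewrite algnorm_scalar ger0_norm.
have uE : u = w - h * w ^+ 2 by rewrite /u hw.
pose S : A := \sum_(j < J) (j.+3)`!%:R^-1 *: u ^+ j.
exists (2 * h ^+ 2 - h ^+ 3 * w - (1 - h * w) ^+ 3 * S).
  have -> : exp_partial u J.+3 = 1 + u + h * u ^+ 2 + w ^+ 3 * ((1 - h * w) ^+ 3 * S).
    rewrite /exp_partial !big_ord_recl /= !fact0 !invr1 expr0 scale1r expr1 scale1r.
    rewrite hw -!addrA; do 4 congr (_ + _).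
    rewrite !mulr_sumr; apply: eq_bigr => -[j /= jJ] _.
    rewrite /bump /= !add1n -!scalerAr; congr (_ *: _).
    by rewrite [u ^+ j.+3](exprD u 3); move: (u ^+ j) => v; rewrite uE; ring.
  by rewrite uE; ring.
have Nu : N u <= 4.
  rewrite /u; apply: le_trans (algnormB _ _ _) _.
  have := algnorm_le_exp 2 w2; rewrite algnormZ ger0_norm//; lra.
have NS : N S <= expR 4.
  apply: le_trans (exp_partial_sum_le J _) => //.
  apply: le_trans (algnorm_sum _ _ _ _) _; apply: ler_sum => -[j /= jJ] _.
  rewrite algnormZ ger0_norm ?invr_ge0//; apply: ler_pM; rewrite ?invr_ge0 ?algnorm_ge0//.
    by rewrite lef_pV2 ?posrE ?ltr0n ?fact_gt0// ler_nat leq_fact//; lia.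
  exact: algnorm_le_exp.
have N1 : N (1 - h * w) <= 2.
  apply: le_trans (algnormB _ _ _) _; rewrite algnorm1.
  have : N (h * w) <= 2^-1 * 2 by rewrite algnorm_le_mul// Nh.
  lra.
apply: le_trans (algnormB _ _ _) _; apply: lerD; last first.
  apply: algnorm_le_mul => //; rewrite (_ : 8 = 2 ^+ 3); last by ring.
  exact: algnorm_le_exp.
apply: le_trans (algnormB _ _ _) _.
have h2 : N (2 * h ^+ 2) <= 2 * (2^-1 ^+ 2).
  apply: algnorm_le_mul; first by rewrite -scaler_nat algnorm_scalar normr_nat.
  by apply: algnorm_le_exp; rewrite Nh.
have h3 : N (h ^+ 3 * w) <= 2^-1 ^+ 3 * 2.
  by apply: algnorm_le_mul => //; apply: algnorm_le_exp; rewrite Nh.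
by move: h2 h3; rewrite !exprS expr0; lra.
Qed.

Variables (I : Type) (p : I -> R) (E E' : I -> A) (F : A) (q Delta : R).
Variables (n k : nat).
Hypothesis kn : (k < n)%N.
Let y := n%:R * q.
Hypothesis HF : symmetric_element N p E E' F q y Delta.
Let w := F - 1.
Let u := w - 2^-1 *: w ^+ 2.
(** The product of 4 (k + 1), from n <= 4 (k + 1) b when a < b, and 3 (k + 1), the number of factors
    w among which the smoothing steps are shared; it also covers the case b <= a. *)
Let kappa : R := (12 * k.+1 ^ 2)%:R.
Let exp_product m := (lazy_factor F q m * bounded_factor F q m) ^+ m.

Let q0 : 0 < q. Proof. by case/andP: (atom01 HF). Qed.
Let q1 : q < 1. Proof. by case/andP: (atom01 HF). Qed.
Let y0 : 0 < y. Proof. by rewrite mulr_gt0// ltr0n (leq_trans _ kn). Qed.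

Let kappa1 : 1 <= kappa. Proof. by rewrite ler1n muln_gt0 expn_gt0. Qed.

Let lazy_le1 m : N (lazy_factor F q m) <= 1.
Proof.
apply: (lazy_distr_le1 HF); case: m => [|m]; first by rewrite mulr0 invr0 mulr0 lexx ler01.
rewrite divr_ge0 ?(ltW q0) ?mulr_ge0//= ler_pdivrMr ?mulr_gt0// mul1r.
have : 1 <= m.+1%:R :> R by rewrite ler1n.
have := q1; lra.
Qed.

(** All bounded factors are collected into one power, which costs 4 / q once. Of the two remaining
    contractions, F^a and the lazy power, the one with the larger of the exponents a and b smooths
    and the other is bounded by 1. *)
Lemma centered_cubes_smoothed_le a b m : (a + b)%N = (n - k.+1)%N -> 4 <= m%:R * q ->
  N (w ^+ (3 * k.+1) * (F ^+ a * exp_product m ^+ b)) <=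
  4 / q * (kappa * Delta / y) ^+ (3 * k.+1).
Proof.
move=> ab mq; set K := (3 * k.+1)%N.
have m0 : (0 < m)%N by case: m mq => // ; rewrite mul0r; lra.
have m0' : 0 < m%:R :> R by rewrite ltr0n.
have NB : N (bounded_factor F q m ^+ (m * b)) <= 4 / q.
  exact: (bounded_factor_pow_le HF).
have -> : w ^+ K * (F ^+ a * exp_product m ^+ b) = bounded_factor F q m ^+ (m * b) *
    (w ^+ K * (F ^+ a * lazy_factor F q m ^+ (m * b))).
  by rewrite /exp_product -exprM exprMn; ring.
apply: algnorm_le_mul => //.
have NF : N (F ^+ a) <= 1 := algnorm_exp_le1 a (distr_le1 HF).
have NL : N (lazy_factor F q m ^+ (m * b)) <= 1 by exact: algnorm_exp_le1.
have [ba|ab'] := leqP b a.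
  rewrite mulrA -[leRHS]mulr1; apply: algnorm_le_mul => //.
  apply: (@centered_pow_le _ _ _ _ _ _ (a %/ K)%N);
    [exact: (distr_le1 HF)| |by rewrite mulnC leq_trunc_div].
  apply: (centered_distr_pow_le HF y0 kappa1).
  rewrite /y ler_wpM2r ?(ltW q0)// -natrM ler_nat.
  have := ltn_ceil a (_ : 0 < K)%N; rewrite /K => /(_ isT).
  set c := (a %/ _)%N; nia.
rewrite mulrCA -[leRHS]mul1r; apply: algnorm_le_mul => //.
apply: (@centered_pow_le _ _ _ _ _ _ ((m * b) %/ K)%N);
  [exact: lazy_le1| |by rewrite mulnC leq_trunc_div].
apply: (centered_lazy_pow_le HF y0 kappa1).
  rewrite divr_gt0 ?mulr_gt0//= ler_pdivrMr ?mulr_gt0//.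
  have : q <= m%:R * q.
    by rewrite ler_peMl ?(ltW q0)// ler1n.
  have : 4 <= m%:R :> R by apply: le_trans mq _; rewrite ger_pMr// ltW.
  have := q1; lra.
set c := ((m * b) %/ K)%N.
rewrite /y mulrA ler_pdivlMr ?mulr_gt0//.
have -> : n%:R * q * (2 * m%:R) = 2 * (n * m)%:R * q by rewrite natrM; ring.
rewrite ler_wpM2r ?(ltW q0)// -mulrA ler_wpM2l// /kappa -natrM ler_nat.
have := ltn_ceil (m * b) (_ : 0 < K)%N; rewrite -/c /K => /(_ isT) => h1.
have h2 : (n <= 4 * k.+1 * b)%N by nia.
nia.
Qed.

Let w2 : N w <= 2.
Proof.
by apply: le_trans (algnormB _ _ _) _; rewrite algnorm1; have := distr_le1 HF; lra.
Qed.

Let u4 : N u <= 4.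
Proof.
rewrite /u; apply: le_trans (algnormB _ _ _) _.
have := algnorm_le_exp 2 w2; have := w2; rewrite algnormZ ger0_norm//; lra.
Qed.

(** The two factors multiply to 1 + u / M with an error 4 / M^2; over M steps this grows to at most
    4 exp 4 / M. The rest is the distance from (1 + u / M)^M to the exponential series. *)
Lemma exp_product_sub_partial_le m :
  N (exp_product m.+1 - exp_partial u m.+2) <= (4 * expR 4 + expR 16) / m.+1%:R.
Proof.
have gen (c b : R) (x v : A) :
    (1 + (c * b) *: x) * (1 + b *: v) - (1 + b *: (v + c *: x)) = (c * b ^+ 2) *: (x * v).
  rewrite mulrDl mul1r mulrDr mulr1 scalerDr -scalerAl -scalerAr !scalerA.
  by rewrite [b * c]mulrC expr2 mulrA; ring.
set M := m.+1; have M0 : 0 < M%:R :> R by rewrite ltr0n.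
set b := M%:R^-1 : R; have b0 : 0 < b by rewrite invr_gt0.
set X := lazy_factor F q M * bounded_factor F q M.
set Y := 1 + b *: u; set v := (1 - q / 2) *: w - 2^-1 *: w ^+ 2.
have XY : X - Y = (q / 2 * b ^+ 2) *: (w * v).
  rewrite /X /Y /lazy_factor /bounded_factor -/w -/b -/v.
  have -> : q / (2 * M%:R) = q / 2 * b by rewrite invfM mulrA.
  have -> : u = v + (q / 2) *: w.
    by rewrite /u /v scalerBl scale1r; ring.
  exact: gen.
have w22 := algnorm_le_exp 2 w2.
have v4 : N v <= 4.
  rewrite /v; apply: le_trans (algnormB _ _ _) _; rewrite !algnormZ !ger0_norm//.
    have : (1 - q / 2) * N w <= 1 * 2.
      by apply: ler_pM; rewrite ?algnorm_ge0//; have := q0; have := q1; lra.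
    by move: w22; rewrite expr2; lra.
  by have := q1; lra.
have NXY : N (X - Y) <= 4 * b ^+ 2.
  rewrite XY algnormZ ger0_norm ?mulr_ge0 ?exprn_ge0 ?(ltW b0) ?divr_ge0 ?(ltW q0)//.
  have : N (w * v) <= 2 * 4 by exact: algnorm_le_mul.
  move=> h; have : q / 2 * b ^+ 2 * N (w * v) <= 2^-1 * b ^+ 2 * 8.
    apply: ler_pM; rewrite ?algnorm_ge0 ?mulr_ge0 ?exprn_ge0 ?(ltW b0) ?divr_ge0 ?(ltW q0)//.
      by rewrite ler_wpM2r ?exprn_ge0 ?(ltW b0)//; have := q1; lra.
    by lra.
  by lra.
have c0 : 0 <= 1 + 4 / M%:R :> R by rewrite addr_ge0 ?divr_ge0.
have NX : N X <= 1 + 4 / M%:R.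
  rewrite -[leRHS]mul1r; apply: algnorm_le_mul => //.
  rewrite /bounded_factor -/w -/v; apply: le_trans (algnormD _ _ _) _.
  by rewrite algnorm1 lerD2l algnormZ ger0_norm ?(ltW b0)// mulrC ler_wpM2r// ltW.
have NY : N Y <= 1 + 4 / M%:R.
  apply: le_trans (algnormD _ _ _) _.
  by rewrite algnorm1 lerD2l algnormZ ger0_norm ?(ltW b0)// mulrC ler_wpM2r// ltW.
have -> : exp_product M - exp_partial u M.+1 =
    (X ^+ M - Y ^+ M) + (Y ^+ M - exp_partial u M.+1).
  by rewrite /exp_product -/X; ring.
apply: le_trans (algnormD _ _ _) _; rewrite mulrDl; apply: lerD; last first.
  exact: algnorm_pow_sub_exp_partial_le.
apply: le_trans (algnorm_subX_le _ c0 NX NY) _.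
have e4 : (1 + 4 / M%:R) ^+ M.-1 <= expR 4 :> R.
  apply: le_trans (expr_1Ddiv_le M _) => //; apply: ler_weXn2l; last exact: leq_pred.
  by rewrite lerDl divr_ge0.
have -> : 4 * expR 4 / M%:R = M%:R * (4 * b ^+ 2) * expR 4 :> R.
  by rewrite /b expr2; field; rewrite gt_eqF.
apply: ler_pM => //; rewrite ?mulr_ge0 ?exprn_ge0 ?algnorm_ge0//.
by rewrite ler_wpM2l// ltW.
Qed.

Variable D : A.
Hypothesis HD : alg_cvg N (exp_partial u) D.

Let HDs i : alg_cvg N (fun m => exp_partial u (m + i)%N) D.
Proof.
rewrite /alg_cvg (@cvg_shiftn i _ (fun m => N (exp_partial u m - D)) (nbhs (0 : R))).
exact: HD.
Qed.

Let exp_product_cvg : alg_cvg N (fun m => exp_product m.+1) D.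
Proof.
have -> : (fun m => exp_product m.+1) = (fun m =>
    (exp_product m.+1 - exp_partial u (m + 2)%N) + exp_partial u (m + 2)%N).
  by apply/funext => m; ring.
rewrite -[X in alg_cvg _ _ X](add0r D); apply: alg_cvgD; last exact: HDs.
apply: (@alg_cvg_le _ _ _ _ _ (fun m => (4 * expR 4 + expR 16) * m.+1%:R^-1)) => [m|].
  by rewrite subr0 addn2; exact: exp_product_sub_partial_le.
rewrite -[X in _ --> X](mulr0 (4 * expR 4 + expR 16)).
by apply: cvgM; [exact: cvg_cst|exact: cvg_harmonic].
Qed.

(** D is approximated in two ways at once: by partial sums inside F - D, where the factor w^3 can be
    extracted, and by [exp_product] inside D^b, where smoothing is available. *)
Lemma expansion_term_le a b : (a + b)%N = (n - k.+1)%N ->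
  N ((F - D) ^+ k.+1 * (F ^+ a * D ^+ b)) <=
  (1 + 8 * expR 4) ^+ k.+1 * (4 / q * (kappa * Delta / y) ^+ (3 * k.+1)).
Proof.
move=> ab; apply: (@alg_cvg_norm_le _ _ _ (fun m => (F - exp_partial u (m + 3)%N) ^+ k.+1 *
   (F ^+ a * exp_product m.+1 ^+ b))).
  apply: alg_cvgM.
    by apply: alg_cvgX; apply: alg_cvgD; [exact: alg_cvg_cst|exact/alg_cvgN/HDs].
  by apply: alg_cvgM; [exact: alg_cvg_cst|exact: alg_cvgX].
near=> m.
have [H FH NH] := exp_partial_third_order m w2.
have -> : F - exp_partial u (m + 3)%N = w ^+ 3 * H.
  by rewrite -FH addn3 -/u /w; ring.
rewrite exprMn -exprM mulrAC mulrC; apply: algnorm_le_mul; first exact: algnorm_le_exp.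
apply: centered_cubes_smoothed_le => //.
rewrite -ler_pdivrMr//; apply: (@le_trans _ _ m%:R); last by rewrite ler_nat.
by near: m; exact: nbhs_infty_ger.
Unshelve. all: by end_near. Qed.

Lemma expansion_remainder_le :
  N (F ^+ n - \sum_(m < k.+1) 'C(n, m)%:R * (D ^+ (n - m) * (F - D) ^+ m)) <=
  n%:R ^+ k.+1 *
    ((1 + 8 * expR 4) ^+ k.+1 * (4 / q * (kappa * Delta / y) ^+ (3 * k.+1))).
Proof.
rewrite bergstrom_identity; last exact: ltnW.
set B := (1 + 8 * expR 4) ^+ k.+1 * _.
have B0 : 0 <= B.
  (* [B] is nonnegative because it bounds the norm of the term with b = 0. *)
  by apply: le_trans (algnorm_ge0 _ _) (@expansion_term_le (n - k.+1) 0 _); rewrite addn0.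
rewrite mulr_sumr; apply: le_trans (algnorm_sum _ _ _ _) _.
apply: (@le_trans _ _ (\sum_(i < n - k) n%:R ^+ k * B)).
  apply: ler_sum => -[i /= ik] _; rewrite mulrCA; apply: algnorm_le_mul.
    rewrite -scaler_nat algnorm_scalar normr_nat -natrX ler_nat.
    apply: leq_trans (leq_bin_exp _ _) _.
    by case: (posnP k) => [->//|k0]; rewrite leq_exp2r//; lia.
  by apply: expansion_term_le; lia.
rewrite sumr_const card_ord -[_ *+ (n - k)]mulr_natl mulrA exprS ler_wpM2r//.
by rewrite ler_wpM2r ?exprn_ge0// ler_nat leq_subr.
Qed.

End expansion_remainder.

(** * Absolutely convergent sums *)

Lemma esum_swap (R : realType) (I J : choiceType) (a : I -> J -> \bar R) :
  (forall i j, 0 <= a i j)%E ->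
  (\esum_(i in [set: I]) \esum_(j in [set: J]) a i j =
   \esum_(j in [set: J]) \esum_(i in [set: I]) a i j)%E.
Proof.
move=> a0; rewrite !esum_esum//.
rewrite (reindex_esum ([set: J] `*`` fun=> [set: I]) _ (fun x => (x.2, x.1)))//.
split=> //=; first by move=> [i1 i2] [j1 j2] _ _ /= [-> ->].
by move=> [i j] _ /=; exists (j, i).
Qed.

(** One inequality holds for every positive constant; applied to the inverse of c it gives the
    other. *)
Lemma esumZl (R : realType) (I : choiceType) (c : R) (f : I -> \bar R) : 0 <= c ->
  (forall i, 0 <= f i)%E ->
  (\esum_(i in [set: I]) (c%:E * f i) = c%:E * \esum_(i in [set: I]) f i)%E.
Proof.
move=> c0 f0; have [->|c1] := eqVneq c 0.
  by rewrite mul0e esum1// => i _; rewrite mul0e.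
have le_aux (d : R) (g : I -> \bar R) : 0 < d -> (forall i, 0 <= g i)%E ->
    (\esum_(i in [set: I]) (d%:E * g i) <= d%:E * \esum_(i in [set: I]) g i)%E.
  move=> d0 g0; apply: ge_ereal_sup => _ [X [finX _] <-].
  rewrite -ge0_mule_fsumr//; apply: lee_wpmul2l; first by rewrite lee_fin ltW.
  by apply: ereal_sup_ubound; exists X.
have c2 : 0 < c by rewrite lt_neqAle eq_sym c1.
apply/eqP; rewrite eq_le le_aux//=.
have := le_aux c^-1 (fun i => c%:E * f i)%E.
rewrite invr_gt0 => /(_ c2) h.
have {h} : (\esum_(i in [set: I]) f i <= c^-1%:E * \esum_(i in [set: I]) (c%:E * f i))%E.
  apply: le_trans (h _); last by move=> i; rewrite mule_ge0// lee_fin.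
  by apply: le_esum => i _; rewrite muleA -EFinM mulVf// mul1e.
move=> /(lee_wpmul2l (_ : 0 <= c%:E)%E) h.
by apply: le_trans (h _) _; rewrite ?lee_fin// muleA -EFinM mulfV// mul1e.
Qed.

Section absolute_sums.
Variables (R : realType) (T : choiceType).
Implicit Types (f g h : T -> R) (c : R).

Definition absum f := (\esum_(x in [set: T]) `|f x|%:E < +oo)%E.

(** Meaningful only under [absum f]: [fine] sends an infinite sum to 0. *)
Definition tsum f : R := fine (\esum_(x in [set: T]) (f^\+ x)%:E)
  - fine (\esum_(x in [set: T]) (f^\- x)%:E).

Lemma absum_nneg_fin f : (forall x, 0 <= f x) -> absum f ->
  (\esum_(x in [set: T]) (f x)%:E \is a fin_num)%E.
Proof.
move=> f0 sf; rewrite ge0_fin_numE; last by apply: esum_ge0 => x _; rewrite lee_fin.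
by apply: le_lt_trans sf; apply: le_esum => x _; rewrite lee_fin ler_norm.
Qed.

Lemma tsum_nneg f : (forall x, 0 <= f x) -> absum f ->
  (tsum f)%:E = (\esum_(x in [set: T]) (f x)%:E)%E.
Proof.
move=> f0 sf; rewrite /tsum (_ : fine (esum _ (fun x => (f^\- x)%:E)) = 0); last first.
  rewrite esum1// => x _; congr (_%:E); rewrite /funrneg; apply/max_idPr.
  by rewrite oppr_le0.
rewrite subr0 -[RHS]fineK ?absum_nneg_fin//; congr (fine _)%:E.
by apply: eq_esum => x _; congr (_%:E); exact/max_idPl.
Qed.

Lemma absum_pos f : absum f -> absum f^\+.
Proof.
apply: le_lt_trans; apply: le_esum => x _; rewrite lee_fin /funrpos.
by rewrite ger0_norm ?le_max ?lexx ?orbT// ge_max ler_norm normr_ge0.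
Qed.

Lemma absum_neg f : absum f -> absum f^\-.
Proof.
apply: le_lt_trans; apply: le_esum => x _; rewrite lee_fin /funrneg.
by rewrite ger0_norm ?le_max ?lexx ?orbT// ge_max normr_ge0 -normrN ler_norm.
Qed.

Let posnegE f x : f x = f^\+ x - f^\- x.
Proof. exact: (congr1 (fun u => u x) (esym (funrposBneg f))). Qed.

Lemma tsum_posneg f : absum f -> tsum f = tsum f^\+ - tsum f^\-.
Proof.
move=> sf; have p0 x : 0 <= f^\+ x by rewrite /funrpos le_max lexx orbT.
have n0 x : 0 <= f^\- x by rewrite /funrneg le_max lexx orbT.
by rewrite {1}/tsum -(tsum_nneg p0 (absum_pos sf)) -(tsum_nneg n0 (absum_neg sf)).
Qed.

Lemma absumD f g : absum f -> absum g -> absum (fun x => f x + g x).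
Proof.
move=> sf sg; apply: le_lt_trans (lte_add_pinfty sf sg); rewrite -esumD//.
by apply: le_esum => x _; rewrite -EFinD lee_fin ler_normD.
Qed.

Lemma absumN f : absum f -> absum (fun x => - f x).
Proof. by apply: le_lt_trans; apply: le_esum => x _; rewrite normrN. Qed.

Lemma absumZ c f : absum f -> absum (fun x => c * f x).
Proof.
move=> sf; rewrite /absum.
under eq_esum => x _ do rewrite normrM EFinM.
by rewrite esumZl// lte_mul_pinfty// lee_fin.
Qed.

Lemma tsum_nnegD f g : (forall x, 0 <= f x) -> (forall x, 0 <= g x) ->
  absum f -> absum g -> tsum (fun x => f x + g x) = tsum f + tsum g.
Proof.
move=> f0 g0 sf sg; apply: EFin_inj; rewrite [RHS]EFinD !tsum_nneg//.
- by rewrite -esumD// => x _; rewrite lee_fin.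
- by move=> x; rewrite addr_ge0.
- exact: absumD.
Qed.

(** With h = f - g, the nonnegative functions h^+ + g and h^- + f coincide, and sums of nonnegative
    functions are already additive. *)
Lemma tsum_sub_nneg f g : (forall x, 0 <= f x) -> (forall x, 0 <= g x) ->
  absum f -> absum g -> tsum (fun x => f x - g x) = tsum f - tsum g.
Proof.
move=> f0 g0 sf sg; set h := fun x => f x - g x.
have sh : absum h by exact/(absumD sf)/absumN.
have p0 x : 0 <= h^\+ x by rewrite /funrpos le_max lexx orbT.
have n0 x : 0 <= h^\- x by rewrite /funrneg le_max lexx orbT.
have : tsum (fun x => h^\+ x + g x) = tsum (fun x => h^\- x + f x).
  congr tsum; apply/funext => x.
  have := posnegE h x; rewrite {1}/h; lra.
have [sp sn] := (absum_pos sh, absum_neg sh).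
rewrite (tsum_nnegD p0 g0 sp sg) (tsum_nnegD n0 f0 sn sf).
by rewrite (tsum_posneg sh) => H; lra.
Qed.

Lemma tsumD f g : absum f -> absum g -> tsum (fun x => f x + g x) = tsum f + tsum g.
Proof.
move=> sf sg; have p0 h x : 0 <= h^\+ x :> R by rewrite /funrpos le_max lexx orbT.
have n0 h x : 0 <= h^\- x :> R by rewrite /funrneg le_max lexx orbT.
have -> : (fun x => f x + g x) = (fun x => (f^\+ x + g^\+ x) - (f^\- x + g^\- x)).
  by apply/funext => x; have := posnegE f x; have := posnegE g x; lra.
have [spf spg] := (absum_pos sf, absum_pos sg).
have [snf sng] := (absum_neg sf, absum_neg sg).
rewrite tsum_sub_nneg ?tsum_nnegD//.
- by rewrite (tsum_posneg sf) (tsum_posneg sg); ring.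
- by move=> x; rewrite addr_ge0.
- by move=> x; rewrite addr_ge0.
- exact: absumD.
- exact: absumD.
Qed.

Lemma absum0 : absum (fun=> 0).
Proof. by rewrite /absum esum1 ?ltry// => x _; rewrite normr0. Qed.

Lemma tsum0 : tsum (fun=> 0) = 0.
Proof. by apply: EFin_inj; rewrite tsum_nneg ?esum1//; exact: absum0. Qed.

Lemma tsumN f : absum f -> tsum (fun x => - f x) = - tsum f.
Proof.
move=> sf; have := tsumD sf (absumN sf).
rewrite (_ : (fun x => f x - f x) = fun=> 0); last by apply/funext => x; rewrite subrr.
by rewrite tsum0 => h; apply/eqP; rewrite -addr_eq0 addrC -h.
Qed.

Lemma tsumB f g : absum f -> absum g -> tsum (fun x => f x - g x) = tsum f - tsum g.
Proof. by move=> sf sg; rewrite (tsumD sf (absumN sg)) tsumN. Qed.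

Lemma tsum_ge0 f : (forall x, 0 <= f x) -> absum f -> 0 <= tsum f.
Proof.
by move=> f0 sf; rewrite -lee_fin tsum_nneg//; apply: esum_ge0 => x _; rewrite lee_fin.
Qed.

Lemma tsum_le f g : (forall x, f x <= g x) -> absum f -> absum g -> tsum f <= tsum g.
Proof.
move=> fg sf sg; rewrite -subr_ge0 -tsumB//; apply: tsum_ge0 => [x|].
  by rewrite subr_ge0.
by apply: absumD => //; exact: absumN.
Qed.

Lemma absum_norm f : absum f -> absum (fun x => `|f x|).
Proof. by apply: le_lt_trans; apply: le_esum => x _; rewrite normr_id. Qed.

Lemma tsum_norm_le f : absum f -> `|tsum f| <= tsum (fun x => `|f x|).
Proof.
move=> sf; have sn := absum_norm sf.
rewrite ler_norml -tsumN//; apply/andP; split.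
  apply: tsum_le => //; last exact: absumN.
  by move=> x; rewrite lerNl ler_normr lexx orbT.
by apply: tsum_le => // x; exact: ler_norm.
Qed.

Lemma tsumZ c f : absum f -> tsum (fun x => c * f x) = c * tsum f.
Proof.
wlog c0 : c / 0 <= c => [H sf|sf].
  have [c0|c0] := leP 0 c; first exact: H.
  rewrite -[RHS]opprK -mulNr -(H (- c))//; last by rewrite oppr_ge0 ltW.
  rewrite -tsumN; last exact: absumZ.
  by congr tsum; apply/funext => x; rewrite mulNr opprK.
have nnegZ g : (forall x, 0 <= g x) -> absum g -> tsum (fun x => c * g x) = c * tsum g.
  move=> g0 sg; apply: EFin_inj; rewrite [RHS]EFinM !tsum_nneg//.
  - by under eq_esum => x _ do rewrite EFinM; rewrite esumZl// => x; rewrite lee_fin.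
  - by move=> x; rewrite mulr_ge0.
  - exact: absumZ.
have p0 x : 0 <= f^\+ x by rewrite /funrpos le_max lexx orbT.
have n0 x : 0 <= f^\- x by rewrite /funrneg le_max lexx orbT.
have [sp sn] := (absum_pos sf, absum_neg sf).
rewrite (tsum_posneg sf) mulrBr -!nnegZ// -tsum_sub_nneg.
- by congr tsum; apply/funext => x; rewrite {1}posnegE mulrBr.
- by move=> x; rewrite mulr_ge0.
- by move=> x; rewrite mulr_ge0.
- exact: absumZ.
- exact: absumZ.
Qed.

Lemma tsum_reindex (e : T -> T) f : bijective e -> tsum (fun x => f (e x)) = tsum f.
Proof.
move=> be; have be' : set_bij [set: T] [set: T] e by rewrite setTT_bijective.
rewrite /tsum (reindex_esum setT setT e (fun x => (f^\+ x)%:E))//.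
by rewrite (reindex_esum setT setT e (fun x => (f^\- x)%:E)).
Qed.

Lemma esum_supp1 (a : T) (f : T -> \bar R) : (forall x, x <> a -> f x = 0%E) ->
  (0 <= f a)%E -> (\esum_(x in [set: T]) f x = f a)%E.
Proof.
move=> f0 fa; have fge0 x : (0 <= f x)%E.
  by have [->//|/eqP/f0 ->] := eqVneq x a.
rewrite (esumID [set a])// setTI [X in (_ + X)%E]esum1 ?adde0 ?esum_set1//.
by move=> x [_ /f0].
Qed.

Lemma absum_supp1 (a : T) f : (forall x, x <> a -> f x = 0) -> absum f.
Proof.
move=> f0; rewrite /absum (@esum_supp1 a) ?ltry ?lee_fin//.
by move=> x /f0 ->; rewrite normr0.
Qed.

Lemma tsum_supp1 (a : T) f : (forall x, x <> a -> f x = 0) -> tsum f = f a.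
Proof.
move=> f0; rewrite [RHS]posnegE /tsum; congr (_ - _).
  rewrite (@esum_supp1 a (fun x => (f^\+ x)%:E))//.
    by move=> x /f0 h; rewrite /funrpos h maxxx.
  by rewrite lee_fin le_max lexx orbT.
rewrite (@esum_supp1 a (fun x => (f^\- x)%:E))//.
  by move=> x /f0 h; rewrite /funrneg h oppr0 maxxx.
by rewrite lee_fin le_max lexx orbT.
Qed.

End absolute_sums.

Lemma esum_ge_term (R : realType) (T : choiceType) (h : T -> \bar R) x :
  (forall x, 0 <= h x)%E -> (h x <= \esum_(x in [set: T]) h x)%E.
Proof.
move=> h0; apply: esum_ge; exists [set x]; last by rewrite fsbig_set1.
by split => //; exact: finite_set1.
Qed.

(** * Fubini for absolutely summable families *)

Section iterated_sums.
Variables (R : realType) (T U : choiceType) (f : T -> U -> R).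
Hypothesis sf : (\esum_(x in [set: T]) \esum_(y in [set: U]) `|f x y|%:E < +oo)%E.

Lemma absum_row x : absum (f x).
Proof.
apply: le_lt_trans sf.
apply: (@esum_ge_term R T (fun x => \esum_(y in [set: U]) `|f x y|%:E)%E x) => z.
by apply: esum_ge0 => y _; rewrite lee_fin.
Qed.

Lemma abs_tsum_le x : (`|tsum (f x)|%:E <= \esum_(y in [set: U]) `|f x y|%:E)%E.
Proof.
have sx := absum_row x.
rewrite -tsum_nneg ?lee_fin ?tsum_norm_le//; exact: absum_norm.
Qed.

Lemma esum_abs_tsum_le : (\esum_(x in [set: T]) `|tsum (f x)|%:E <=
  \esum_(x in [set: T]) \esum_(y in [set: U]) `|f x y|%:E)%E.
Proof. by apply: le_esum => x _; exact: abs_tsum_le. Qed.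

Lemma absum_tsum : absum (fun x => tsum (f x)).
Proof. exact: le_lt_trans esum_abs_tsum_le sf. Qed.

End iterated_sums.

(** Reduces a signed double sum to two nonnegative ones, whose order of summation can be exchanged
    freely. *)
Lemma iterated_tsumE (R : realType) (T U : choiceType) (f : T -> U -> R) :
  (\esum_(x in [set: T]) \esum_(y in [set: U]) `|f x y|%:E < +oo)%E ->
  tsum (fun x => tsum (f x)) =
  fine (\esum_(x in [set: T]) \esum_(y in [set: U]) (Num.max (f x y) 0)%:E) -
  fine (\esum_(x in [set: T]) \esum_(y in [set: U]) (Num.max (- f x y) 0)%:E).
Proof.
move=> sf; have sub g : (forall x y, 0 <= g x y <= `|f x y|) ->
    (\esum_(x in [set: T]) \esum_(y in [set: U]) `|g x y|%:E < +oo)%E /\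
    (tsum (fun x => tsum (g x)))%:E =
      (\esum_(x in [set: T]) \esum_(y in [set: U]) (g x y)%:E)%E.
  move=> gf; have g0 x y : 0 <= g x y by case/andP: (gf x y).
  have sg : (\esum_(x in [set: T]) \esum_(y in [set: U]) `|g x y|%:E < +oo)%E.
    apply: le_lt_trans sf; apply: le_esum => x _; apply: le_esum => y _.
    by rewrite lee_fin ger0_norm//; case/andP: (gf x y).
  split=> //; rewrite tsum_nneg; [|by move=> x; exact/tsum_ge0/absum_row|exact: absum_tsum].
  by apply: eq_esum => x _; rewrite tsum_nneg//; exact: absum_row.
have hp x y : 0 <= Num.max (f x y) 0 <= `|f x y|.
  by rewrite le_max lexx orbT ge_max ler_norm normr_ge0.
have hn x y : 0 <= Num.max (- f x y) 0 <= `|f x y|.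
  by rewrite le_max lexx orbT ge_max normr_ge0 -normrN ler_norm.
have [sp <-] := sub _ hp; have [sn <-] := sub _ hn.
rewrite /= -tsum_sub_nneg.
- congr tsum; apply/funext => x; rewrite (tsum_posneg (absum_row sf x))//.
- by move=> x; apply: tsum_ge0 (absum_row sp x) => y; case/andP: (hp x y).
- by move=> x; apply: tsum_ge0 (absum_row sn x) => y; case/andP: (hn x y).
- exact: absum_tsum.
- exact: absum_tsum.
Qed.

Lemma tsum_swap (R : realType) (T U : choiceType) (f : T -> U -> R) :
  (\esum_(x in [set: T]) \esum_(y in [set: U]) `|f x y|%:E < +oo)%E ->
  tsum (fun x => tsum (fun y => f x y)) = tsum (fun y => tsum (fun x => f x y)).
Proof.
move=> sf; rewrite iterated_tsumE// iterated_tsumE; last by rewrite esum_swap.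
by congr (fine _ - fine _); rewrite esum_swap// => x y; rewrite lee_fin le_max lexx orbT.
Qed.

(** * The convolution algebra *)

(** The discrete measure algebra of an abelian group. Summability is bundled, so that convolution is
    a total operation and the ring structures apply. *)
Record l1 (R : realType) (T : zmodType) := L1 { l1_fun :> T -> R; l1P : absum l1_fun }.

HB.instance Definition _ (R : realType) (T : zmodType) := gen_eqMixin (l1 R T).
HB.instance Definition _ (R : realType) (T : zmodType) := gen_choiceMixin (l1 R T).

Section l1_algebra.
Variables (R : realType) (T : zmodType).
Implicit Types (f g h : l1 R T).

Lemma l1_ext f g : (forall x, f x = g x) -> f = g.
Proof.
case: f g => [f sf] [g sg] /= /funext fg; move: sf sg; rewrite fg => sf sg.
by congr L1; exact: Prop_irrelevance.
Qed.

Definition l1_zero : l1 R T := L1 (absum0 R T).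
Definition l1_opp f : l1 R T := L1 (absumN (l1P f)).
Definition l1_add f g : l1 R T := L1 (absumD (l1P f) (l1P g)).
Definition l1_scale (c : R) f : l1 R T := L1 (absumZ c (l1P f)).

Lemma l1_addA : associative l1_add.
Proof. by move=> f g h; apply: l1_ext => x /=; rewrite addrA. Qed.
Lemma l1_addC : commutative l1_add.
Proof. by move=> f g; apply: l1_ext => x /=; rewrite addrC. Qed.
Lemma l1_add0 : left_id l1_zero l1_add.
Proof. by move=> f; apply: l1_ext => x /=; rewrite add0r. Qed.
Lemma l1_addN : left_inverse l1_zero l1_opp l1_add.
Proof. by move=> f; apply: l1_ext => x /=; rewrite addNr. Qed.

HB.instance Definition _ := GRing.isZmodule.Build (l1 R T)
  l1_addA l1_addC l1_add0 l1_addN.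

Lemma l1_addE f g x : (f + g) x = f x + g x. Proof. by []. Qed.
Lemma l1_oppE f x : (- f) x = - f x. Proof. by []. Qed.

Definition l1_norm f : R := tsum (fun x => `|f x|).

Lemma esum_l1_norm f : (\esum_(x in [set: T]) `|f x|%:E = (l1_norm f)%:E)%E.
Proof. by rewrite tsum_nneg//; exact/absum_norm/l1P. Qed.

Lemma le_l1_norm f x : `|f x| <= l1_norm f.
Proof.
rewrite -lee_fin -esum_l1_norm; apply: (@esum_ge_term R T (fun x => `|f x|%:E)%E x) => y.
by rewrite lee_fin.
Qed.

Lemma subr_bijective (z : T) : bijective (fun x => z - x).
Proof. by exists (fun x => z - x) => x; rewrite subKr. Qed.

Lemma addr_bijective (z : T) : bijective (fun x => x + z).
Proof. by exists (fun x => x - z) => x; rewrite ?addrK ?subrK. Qed.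

Lemma esum_convolution f g :
  (\esum_(z in [set: T]) \esum_(x in [set: T]) `|f x * g (z - x)|%:E =
   (l1_norm f * l1_norm g)%:E)%E.
Proof.
rewrite esum_swap; last by move=> z x; rewrite lee_fin.
transitivity (\esum_(x in [set: T]) ((l1_norm g)%:E * `|f x|%:E))%E.
  apply: eq_esum => x _; rewrite muleC.
  under eq_esum => z _ do rewrite normrM EFinM.
  rewrite esumZl//; congr (_ * _)%E; rewrite -esum_l1_norm.
  rewrite (reindex_esum [set: T] [set: T] (fun z => z - x))// setTT_bijective.
  exact: addr_bijective.
rewrite esumZl ?esum_l1_norm -?EFinM 1?mulrC//.
by apply: tsum_ge0; [|exact/absum_norm/l1P].
Qed.

Lemma convolution_summable f g :
  (\esum_(z in [set: T]) \esum_(x in [set: T]) `|f x * g (z - x)|%:E < +oo)%E.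
Proof. by rewrite esum_convolution ltry. Qed.

Definition l1_mul f g : l1 R T := L1 (absum_tsum (convolution_summable f g)).

Definition l1_delta (a : T) : l1 R T :=
  @L1 R T (fun x => (x == a)%:R) (@absum_supp1 _ _ a _
    (fun x (h : x <> a) => congr1 (fun b : bool => b%:R) (introF eqP h))).

Lemma l1_mulE f g z : l1_mul f g z = tsum (fun x => f x * g (z - x)).
Proof. by []. Qed.

Lemma absum_convolution f g z : absum (fun x => f x * g (z - x)).
Proof. exact: absum_row (convolution_summable f g) z. Qed.

Lemma l1_mulC : commutative l1_mul.
Proof.
move=> f g; apply: l1_ext => z; rewrite !l1_mulE -(tsum_reindex _ (subr_bijective z)).
by congr tsum; apply/funext => x; rewrite subKr mulrC.
Qed.

Lemma l1_mulA : associative l1_mul.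
Proof.
move=> f g h; apply: l1_ext => z; rewrite !l1_mulE.
transitivity (tsum (fun u => tsum (fun x => f x * g (u - x) * h (z - u)))); last first.
  congr tsum; apply/funext => u; rewrite l1_mulE mulrC -tsumZ; last exact: absum_convolution.
  by congr tsum; apply/funext => x; rewrite mulrC.
rewrite tsum_swap; last first.
  (* Fubini is justified by bounding the values of h by its norm, which leaves the convolution of f
     and g. *)
  apply: (@le_lt_trans _ _ (\esum_(u in [set: T]) ((l1_norm h)%:E *
      \esum_(x in [set: T]) `|f x * g (u - x)|%:E))%E); last first.
    rewrite esumZl.
    - by rewrite esum_convolution -EFinM ltry.
    - by apply: tsum_ge0; [|exact/absum_norm/l1P].
    - by move=> i; apply: esum_ge0 => x _; rewrite lee_fin.
  apply: le_esum => u _; rewrite -esumZl; last 2 first.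
  - by apply: tsum_ge0; [|exact/absum_norm/l1P].
  - by move=> x; rewrite lee_fin.
  apply: le_esum => x _; rewrite -EFinM lee_fin normrM mulrC ler_wpM2r//.
  exact: le_l1_norm.
congr tsum; apply/funext => x; rewrite l1_mulE -tsumZ; last exact: absum_convolution.
rewrite -[RHS](tsum_reindex _ (addr_bijective x)); congr tsum; apply/funext => y.
by rewrite addrK mulrA opprD addrA addrAC.
Qed.

Lemma l1_mul_delta a f z : l1_mul (l1_delta a) f z = f (z - a).
Proof.
rewrite l1_mulE (@tsum_supp1 _ _ a) /= ?eqxx ?mul1r// => x /eqP/negPf ->.
by rewrite mul0r.
Qed.

Lemma l1_mul1 : left_id (l1_delta 0) l1_mul.
Proof. by move=> f; apply: l1_ext => x; rewrite l1_mul_delta subr0. Qed.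

Lemma l1_mulDl : left_distributive l1_mul l1_add.
Proof.
move=> f g h; apply: l1_ext => z /=; rewrite -tsumD; do ?exact: absum_convolution.
by congr tsum; apply/funext => x; rewrite mulrDl.
Qed.

Lemma l1_one_neq0 : l1_delta 0 != 0.
Proof.
apply/eqP => /(congr1 (fun f : l1 R T => f 0)) /= /eqP.
by rewrite eqxx oner_eq0.
Qed.

HB.instance Definition _ := GRing.Zmodule_isComNzRing.Build (l1 R T)
  l1_mulA l1_mulC l1_mul1 l1_mulDl l1_one_neq0.

Lemma l1_scaleA a b f : l1_scale a (l1_scale b f) = l1_scale (a * b) f.
Proof. by apply: l1_ext => x /=; rewrite mulrA. Qed.
Lemma l1_scale1 : left_id 1 l1_scale.
Proof. by move=> f; apply: l1_ext => x /=; rewrite mul1r. Qed.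
Lemma l1_scaleDr : right_distributive l1_scale +%R.
Proof. by move=> a f g; apply: l1_ext => x /=; rewrite mulrDr. Qed.
Lemma l1_scaleDl f : {morph l1_scale^~ f : a b / a + b}.
Proof. by move=> a b; apply: l1_ext => x /=; rewrite mulrDl. Qed.

HB.instance Definition _ := GRing.Zmodule_isLmodule.Build R (l1 R T)
  l1_scaleA l1_scale1 l1_scaleDr l1_scaleDl.

Lemma l1_scaleAl (a : R) f g : a *: (f * g) = a *: f * g.
Proof.
apply: l1_ext => z /=; rewrite -tsumZ; last exact: absum_convolution.
by congr tsum; apply/funext => x; rewrite mulrA.
Qed.

HB.instance Definition _ := GRing.Lmodule_isLalgebra.Build R (l1 R T) l1_scaleAl.
HB.instance Definition _ := GRing.Lalgebra_isComAlgebra.Build R (l1 R T).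

Lemma l1_scaleE a f x : (a *: f) x = a * f x. Proof. by []. Qed.
Lemma l1_oneE x : (1 : l1 R T) x = (x == 0)%:R. Proof. by []. Qed.

Lemma l1_normD f g : l1_norm (f + g) <= l1_norm f + l1_norm g.
Proof.
have := (absum_norm (l1P f), absum_norm (l1P g)) => -[sf sg].
rewrite /l1_norm -tsumD//; apply: tsum_le; [|exact/absum_norm/l1P|exact: absumD].
by move=> x; exact: ler_normD.
Qed.

Lemma l1_normZ a f : l1_norm (a *: f) = `|a| * l1_norm f.
Proof.
rewrite /l1_norm -tsumZ; last exact/absum_norm/l1P.
by congr tsum; apply/funext => x; rewrite -normrM.
Qed.

Lemma l1_normM f g : l1_norm (f * g) <= l1_norm f * l1_norm g.
Proof.
rewrite -lee_fin -esum_convolution -esum_l1_norm.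
exact: esum_abs_tsum_le (convolution_summable f g).
Qed.

Lemma l1_norm_delta a : l1_norm (l1_delta a) = 1.
Proof.
rewrite /l1_norm (@tsum_supp1 _ _ a) /= ?eqxx ?normr1// => x /eqP/negPf ->.
by rewrite normr0.
Qed.

Definition l1_algnorm : algebra_norm (l1 R T) :=
  AlgebraNorm l1_normD l1_normZ l1_normM (l1_norm_delta 0).

Lemma l1_delta_mul a b : l1_delta a * l1_delta b = l1_delta (a + b).
Proof.
by apply: l1_ext => x; rewrite [LHS]l1_mul_delta /= subr_eq addrC.
Qed.

End l1_algebra.

(** * Symmetric distributions in the convolution algebra *)

Lemma sum_pred1_seq (V : nmodType) (T : eqType) (s : seq T) (z : T) (f : T -> V) :
  uniq s -> \sum_(x <- s | x == z) f x = if z \in s then f z else 0.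
Proof.
move=> us; case: ifPn => zs; first by rewrite -big_filter filter_pred1_uniq// big_seq1.
by rewrite big_seq_cond big1// => x /andP[xs /eqP xz]; rewrite -xz xs in zs.
Qed.

Section l1_distributions.
Variables (R : realType) (T : zmodType).
Implicit Types (f g : l1 R T).

Definition l1_total f : R := tsum f.

Lemma l1_totalD f g : l1_total (f + g) = l1_total f + l1_total g.
Proof. exact: tsumD (l1P f) (l1P g). Qed.

Lemma l1_totalN f : l1_total (- f) = - l1_total f.
Proof. exact: tsumN (l1P f). Qed.

Lemma l1_totalZ c f : l1_total (c *: f) = c * l1_total f.
Proof. exact: tsumZ (l1P f). Qed.

Lemma l1_total_delta a : l1_total (l1_delta R a) = 1.
Proof. by rewrite /l1_total (@tsum_supp1 _ _ a) /= ?eqxx// => x /eqP/negPf ->. Qed.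

Lemma l1_total_sum (I : Type) (s : seq I) (f : I -> l1 R T) :
  l1_total (\sum_(i <- s) f i) = \sum_(i <- s) l1_total (f i).
Proof.
elim: s => [|i s IH]; first by rewrite !big_nil; exact: tsum0.
by rewrite !big_cons l1_totalD IH.
Qed.

Lemma l1_sumE (I : Type) (s : seq I) (f : I -> l1 R T) x :
  (\sum_(i <- s) f i) x = \sum_(i <- s) f i x.
Proof.
elim: s => [|i s IH]; first by rewrite !big_nil.
by rewrite !big_cons -IH.
Qed.

Lemma l1_norm_nneg f : (forall x, 0 <= f x) -> l1_norm f = l1_total f.
Proof. by move=> f0; congr tsum; apply/funext => x; rewrite ger0_norm. Qed.

Variable F : l1 R T.
Hypothesis F0 : forall x, 0 <= F x.
Hypothesis F1 : l1_total F = 1.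
Hypothesis Fsym : forall x, F (- x) = F x.
Hypothesis Fatom : 0 < F 0 < 1.
Hypothesis tf2 : forall x : T, x = - x -> x = 0.
Variables (y Delta : R).
Hypothesis Delta_ub : forall s : seq T, uniq s -> 0 \notin s ->
  \sum_(x <- s) Num.min 1 (4 * y * F x) <= Delta.

(** Zero at the origin: the index 0 is allowed in [symmetric_element], and its mass is already
    counted in q. *)
Let p (x : T) : R := if x == 0 then 0 else F x.
Let N := l1_algnorm R T.

(** Removing some of the atoms leaves a nonnegative function, whose norm is its total mass. *)
Let rest_norm (s : seq T) : uniq s -> 0 \notin s ->
  N (F - (F 0)%:A - \sum_(x <- s) F x *: l1_delta R x) = 1 - F 0 - \sum_(x <- s) F x.
Proof.
move=> us s0; rewrite [LHS]l1_norm_nneg => [|z].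
  rewrite !(l1_totalD, l1_totalN) F1 l1_totalZ [l1_total 1]l1_total_delta mulr1.
  rewrite l1_total_sum; congr (_ - _); apply: eq_bigr => x _.
  by rewrite l1_totalZ l1_total_delta mulr1.
rewrite !(l1_addE, l1_oppE, l1_scaleE, l1_oneE) l1_sumE.
under eq_bigr => x _ do rewrite l1_scaleE /=.
have [->|z0] := eqVneq z 0.
  rewrite mulr1 subrr sub0r oppr_ge0 big_seq big1// => x xs.
  by rewrite (_ : (0 == x) = false) ?mulr0//; apply: contraNF s0 => /eqP ->.
rewrite mulr0 subr0 subr_ge0 (bigID (pred1 z)) /= [X in _ + X]big1 ?addr0; last first.
  by move=> x /negPf xz; rewrite eq_sym xz mulr0.
rewrite sum_pred1_seq//; case: ifP => _; last exact: F0.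
by rewrite eqxx mulr1.
Qed.

(** For x <> 0 the absence of 2-torsion makes x and -x distinct atoms, so what is left of F after
    removing a at 0 and b at each of them is nonnegative and has norm 1 - (a + 2 b). *)
Lemma symmetric_element_l1 :
  symmetric_element N p (@l1_delta R T) (fun x => l1_delta R (- x)) F (F 0) y Delta.
Proof.
have p0 x : 0 <= p x by rewrite /p; case: ifP.
have FN : N F = 1 by rewrite -F1 [LHS]l1_norm_nneg.
split=> //.
- by move=> x; rewrite l1_delta_mul subrr.
- by move=> x; rewrite [leLHS]l1_norm_delta.
- by move=> x; rewrite [leLHS]l1_norm_delta.
- by rewrite FN.
- by have := @rest_norm [::] isT isT; rewrite !big_nil !subr0 => ->.
- move=> x a b /andP[a0 aq] /andP[b0 bp]; rewrite [leLHS]l1_norm_nneg => [|z].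
    rewrite !(l1_totalD, l1_totalN, l1_totalZ) F1 [l1_total 1]l1_total_delta.
    by rewrite !l1_total_delta; lra.
  rewrite !(l1_addE, l1_oppE, l1_scaleE, l1_oneE) /= subr_ge0.
  move: bp; rewrite /p; case: eqVneq => [_ bp|x0 bp].
    have -> : b = 0 by apply/eqP; rewrite eq_le b0 bp.
    rewrite mul0r addr0; case: eqVneq => [->|_]; first by rewrite mulr1.
    by rewrite mulr0.
  have xx : x <> - x by move=> /tf2 /eqP; rewrite (negPf x0).
  have [->|z0] := eqVneq z 0.
    by rewrite ![0 == _]eq_sym oppr_eq0 (negPf x0) mulr1 addr0 mulr0 addr0.
  have [->|zx] := eqVneq z x.
    by rewrite (_ : (x == - x) = false) ?mulr0 ?add0r ?addr0 ?mulr1//; apply/eqP.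
  have [->|zx'] := eqVneq z (- x); first by rewrite Fsym mulr0 !add0r mulr1.
  by rewrite addr0 !mulr0 addr0.
move=> e e0.
(* Half of e, because the mass c missed by [s] enters the error twice: through the mean of [r] and
   [r'], and through the scalar c. *)
have : ((1 - e / 2)%:E < \esum_(x in [set: T]) (F x)%:E)%E.
  by rewrite -tsum_nneg//; [rewrite [tsum _]F1 lte_fin; lra|exact: l1P].
move=> /ereal_sup_gt[_ [X [finX _]] <-].
rewrite fsbig_finite//= sumEFin lte_fin => hX.
have := finmap.fset_uniq (fset_set X).
move: (finmap.enum_fset (fset_set X)) hX => fs hX ufs.
pose s := [seq x <- fs | x != 0].
have us : uniq s by rewrite filter_uniq.
have s0 : 0 \notin s by rewrite mem_filter eqxx.
have sX : 1 - F 0 - \sum_(x <- s) F x <= e / 2.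
  have : \sum_(x <- fs) F x <= F 0 + \sum_(x <- s) F x.
    rewrite (bigID (pred1 0)) /= big_filter lerD2r sum_pred1_seq//.
    by case: ifP => _ //; exact: F0.
  by lra.
have ps x : x \in s -> p x = F x by rewrite /p mem_filter => /andP[/negPf ->].
exists s; last first.
  apply: le_trans (Delta_ub us s0); rewrite [leLHS]big_seq [leRHS]big_seq.
  by apply: ler_sum => x /ps ->.
set c := 1 - F 0 - _ in sX.
set r := F - (F 0)%:A - \sum_(x <- s) F x *: l1_delta R x.
(* The reflection of [r]; averaging the two produces the pairs E_x + E_-x without requiring [s] to
   be symmetric. *)
set r' := F - (F 0)%:A - \sum_(x <- s) F x *: l1_delta R (- x).
have Nr : N r = c by exact: rest_norm.
have Nr' : N r' = c.
  have := @rest_norm [seq - x | x <- s]; rewrite !big_map (map_inj_uniq (@oppr_inj T)).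
  under eq_bigr => x _ do rewrite Fsym.
  under [X in 1 - F 0 - X]eq_bigr => x _ do rewrite Fsym.
  apply => //; apply: contra s0 => /mapP[x xs /eqP].
  by rewrite eq_sym oppr_eq0 => /eqP <-.
have -> : F - 1 - \sum_(x <- s) (p x / 2) *: (l1_delta R x + l1_delta R (- x) - 2%:R) =
    2^-1 *: r + 2^-1 *: r' - c%:A.
  have -> : \sum_(x <- s) (p x / 2) *: (l1_delta R x + l1_delta R (- x) - 2%:R) =
     2^-1 *: \sum_(x <- s) F x *: l1_delta R x +
     2^-1 *: \sum_(x <- s) F x *: l1_delta R (- x)
     - (\sum_(x <- s) F x)%:A.
    rewrite !scaler_sumr scaler_suml -big_split /= -sumrB big_seq [RHS]big_seq.
    apply: eq_bigr => x xs; rewrite ps// scalerBr scalerDr -[2%:R : l1 R T]scaler_nat !scalerA.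
    by rewrite divfK// [2^-1 * _]mulrC.
  rewrite /r /r' /c !scalerBl !scalerBr !scale1r scalerA.
  have h (x : l1 R T) : x = 2^-1 *: x + 2^-1 *: x.
    by rewrite -scalerDl (_ : 2^-1 + 2^-1 = 1) ?scale1r//; lra.
  rewrite {1}[F]h [(F 0)%:A]h !scalerA; ring.
apply: le_trans (algnormB N _ _) _; rewrite algnorm_scalar.
have c0 : 0 <= c by rewrite -Nr; exact: algnorm_ge0.
have := algnormD N (2^-1 *: r) (2^-1 *: r').
rewrite !algnormZ Nr Nr' !ger0_norm//; lra.
Qed.

End l1_distributions.

(** * Charges on the lattice *)

Section countable_image.
Local Open Scope ereal_scope.
Context d (T : measurableType d) (R : realType) (mu : {measure set T -> \bar R}).
Variables (I : countType) (iota : I -> T).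
Hypothesis iota_inj : injective iota.
Hypothesis iota_meas : forall i, measurable [set iota i].

Let G (A : set T) (n : nat) : set T :=
  if pickle_inv n is Some i then [set iota i] `&` A else set0.

Let GE A : A `&` range iota = \bigcup_n G A n.
Proof.
apply/seteqP; split => [x [Ax [i _ ix]]|x [n _]]; rewrite /G.
  by exists (pickle i) => //=; rewrite pickleK_inv; split => //=.
by case: pickle_inv => // i [/= -> ?]; split => //; exists i.
Qed.

Lemma measurable_countable_range : measurable (range iota).
Proof.
rewrite -[range iota]setTI GE; apply: bigcupT_measurable => n; rewrite /G.
by case: pickle_inv => [i|//]; rewrite setIT; exact: iota_meas.
Qed.

Lemma measure_countable_range A : measurable A ->
  mu (A `&` range iota) = \esum_(i in [set i | A (iota i)]) mu [set iota i].
Proof.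
move=> mA; have mG n : measurable (G A n).
  by rewrite /G; case: pickle_inv => [i|//]; apply: measurableI.
have tG : trivIset setT (G A).
  apply/trivIsetP => n m _ _ nm; apply/seteqP; split => // x [].
  rewrite /G; case En: (pickle_inv n) => [i|//]; case Em: (pickle_inv m) => [j|//].
  move=> [/= -> _] [/iota_inj ij _]; move/eqP: nm; apply.
  have := @pickle_invK I n; have := @pickle_invK I m.
  by rewrite /= En Em /= ij => -> ->.
rewrite GE measure_semi_bigcup//; last exact: bigcupT_measurable.
rewrite nneseries_esumT//.
have -> : \esum_(n in [set: nat]) mu (G A n) =
    \esum_(n in pickle @` [set i | A (iota i)]) mu (G A n).
  rewrite [RHS]esum_mkcond; apply: eq_esum => n _; case: ifPn => //.
  rewrite notin_setE => nA; rewrite /G; case En: (pickle_inv n) => [i|]; last first.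
    by rewrite measure0.
  rewrite (_ : _ `&` _ = set0) ?measure0//; apply/seteqP; split => // x [/= -> Ai].
  by apply: nA; exists i => //; have := @pickle_invK I n; rewrite /= En.
rewrite esum_image; last by move=> i j _ _; exact: (pcan_inj pickleK_inv).
apply: eq_esum => i /= Ai; rewrite /G pickleK_inv; congr (mu _).
by apply/seteqP; split => [x []//|x /= ->].
Qed.

Lemma measure_countable_image A : measurable A -> mu (~` range iota) = 0 ->
  mu A = \esum_(i in [set i | A (iota i)]) mu [set iota i].
Proof.
move=> mA mu0; rewrite -measure_countable_range//.
have mr := measurable_countable_range.
rewrite -[in LHS](setIT A) -(setUv (range iota)) setIUr measureU0//.
- exact: measurableI.
- exact/measurableI/measurableC.
- apply: (@subset_measure0 _ _ _ mu _ (~` range iota)) => //.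
  + exact/measurableI/measurableC.
  + exact: measurableC.
Qed.

End countable_image.

(** * From charges on the lattice to the convolution algebra *)

Section lattice_charges.
Variables (R : realType) (d : nat).
Local Notation V := 'rV[R]_d.
Local Notation Z := 'rV[int]_d.
Local Notation lat := (@lattice_pt R d).
Local Notation smeasure := ({charge set V -> \bar R})%R.
Local Notation fmeasure := ({finite_measure set V -> \bar R})%R.
Local Notation lattice := (range lat).

Lemma lattice_ptD x y : lat (x + y) = lat x + lat y.
Proof. exact: (map_mxD intr). Qed.

Lemma lattice_pt0 : lat 0 = 0.
Proof. exact: (map_mx0 intr). Qed.

Lemma lattice_ptN x : lat (- x) = - lat x.
Proof. exact: (map_mxN intr). Qed.

Lemma lattice_pt_inj : injective lat.
Proof.
move=> x y /matrixP xy; apply/matrixP => i j.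
by have := xy i j; rewrite !mxE => /intr_inj.
Qed.

Lemma measurable_point (v : V) : measurable [set v].
Proof.
apply: measurable_closed_mx; rewrite -[X in closed X]setCK; apply: open_closedC.
rewrite openE => x /eqP xv.
have [i [j xyij]] : exists i j, x i j != v i j.
  apply: contrapT => h; move/eqP: xv; apply; apply/matrixP => i j.
  by apply/eqP; apply: contrapT => /negP hij; apply: h; exists i, j.
rewrite /interior -nbhs_ballE; exists `|x i j - v i j|; first by rewrite /= normr_gt0 subr_eq0.
move=> z [_ /(_ i j)] /=; rewrite /ball /= => h zv.
by move: h; rewrite zv ltxx.
Qed.

Lemma measurable_lattice : measurable lattice.
Proof. by apply: measurable_countable_range => i; exact: measurable_point. Qed.

(** [charge_l1] sees only the atoms at lattice points; on charges of this kind it turns convolution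
    into the product. *)
Definition lattice_charge (M : smeasure) : Prop :=
  forall A, measurable A -> A `&` lattice = set0 -> (M A = 0)%E.

Lemma absum_finite_measure (m : fmeasure) : absum (fun z => fine (m [set lat z])).
Proof.
have mz z := fin_num_measure m _ (measurable_point (lat z)).
rewrite /absum (eq_esum (b := fun z => m [set lat z])); last first.
  by move=> z _; rewrite ger0_norm ?fine_ge0// fineK//; exact: mz.
have := measure_countable_range m lattice_pt_inj (fun z => measurable_point _) measurableT.
rewrite setTI => <-; rewrite -ge0_fin_numE//.
by apply: fin_num_measure; exact: measurable_lattice.
Qed.

Definition finite_measure_l1 (m : fmeasure) : l1 R Z := L1 (absum_finite_measure m).

Lemma charge_pointE (M : smeasure) z : fine (M [set lat z]) =
  fine (pos_part M [set lat z]) - fine (neg_part M [set lat z]).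
Proof.
have mz := measurable_point (lat z).
by rewrite charge_partsE// fineB//; exact: fin_num_measure.
Qed.

Lemma absum_charge (M : smeasure) : absum (fun z => fine (M [set lat z])).
Proof.
rewrite (_ : (fun z => _) = (finite_measure_l1 (pos_part M) - finite_measure_l1 (neg_part M))).
  exact: l1P.
by apply/funext => z; rewrite charge_pointE.
Qed.

Definition charge_l1 (M : smeasure) : l1 R Z := L1 (absum_charge M).

Lemma charge_l1_parts (M : smeasure) :
  charge_l1 M = finite_measure_l1 (pos_part M) - finite_measure_l1 (neg_part M).
Proof. by apply: l1_ext => z; rewrite /= charge_pointE. Qed.

Lemma charge_l1E (M : smeasure) z : (M [set lat z] = (charge_l1 M z)%:E)%E.
Proof. by rewrite /= fineK//; apply: fin_num_measure; exact: measurable_point. Qed.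

(** The positive part of a set is the charge of its trace on a Hahn set, and that trace misses the
    lattice as well. *)
Lemma pos_part_lattice (M : smeasure) : lattice_charge M -> pos_part M (~` lattice) = 0%E.
Proof.
move=> LM; have [[mP _] _ _ _] := svalP (hahn_sig M).
have mL := measurableC measurable_lattice.
rewrite /pos_part/= jordan_posE cjordan_posE /crestr0 mem_set//= /crestr LM//.
  exact: measurableI.
by apply/seteqP; split => // x [[]].
Qed.

Lemma neg_part_lattice (M : smeasure) : lattice_charge M -> neg_part M (~` lattice) = 0%E.
Proof.
move=> LM; have [_ [mN _] _ _] := svalP (hahn_sig M).
have mL := measurableC measurable_lattice.
rewrite /neg_part/= jordan_negE cjordan_negE /crestr0 mem_set//= /crestr LM ?oppe0//.
  exact: measurableI.
by apply/seteqP; split => // x [[]].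
Qed.

Lemma product_measure_offlattice (m1 m2 : fmeasure) (B : set (V * V)) :
  m1 (~` lattice) = 0%E -> m2 (~` lattice) = 0%E -> measurable B ->
  B `&` (lattice `*` lattice) = set0 -> ((m1 \x m2) B = 0)%E.
Proof.
move=> m10 m20 mB B0; have mL := measurableC measurable_lattice.
apply: (@subset_measure0 _ _ _ (m1 \x m2)%E _
  ((~` lattice) `*` setT `|` setT `*` (~` lattice))) => //.
- by apply: measurableU; exact: measurableX.
- move=> [x y] Bxy; have [Lx|] := pselect (lattice x); last by left.
  have [Ly|] := pselect (lattice y); last by right.
  by exfalso; rewrite -[False]/(set0 (x, y)) -B0.
have h1 : (m1 \x m2)%E ((~` lattice) `*` setT) = 0%E.
  transitivity (m1 (~` lattice) * m2 setT)%E; last by rewrite m10 mul0e.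
  exact: product_measure1E.
have h2 : (m1 \x m2)%E (setT `*` (~` lattice)) = 0%E.
  transitivity (m1 setT * m2 (~` lattice))%E; last by rewrite m20 mule0.
  exact: product_measure1E.
by apply: null_set_setU => //; exact: measurableX.
Qed.

Lemma measurable_add_preimage (A : set V) : measurable A ->
  measurable ((fun z : V * V => z.1 + z.2) @^-1` A).
Proof. by move=> mA; rewrite -[X in measurable X]setTI; exact: measurable_add_mx. Qed.

(** Within pairs of lattice points the fibre of addition over z is the countable set of the (x, z -
    x), whose atoms add up to the convolution sum. *)
Lemma product_measure_add (m1 m2 : fmeasure) z :
  m1 (~` lattice) = 0%E -> m2 (~` lattice) = 0%E ->
  ((m1 \x m2) ((fun z => z.1 + z.2)%R @^-1` [set lat z]) =
   ((finite_measure_l1 m1 * finite_measure_l1 m2) z)%:E)%E.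
Proof.
move=> m10 m20; pose iota (i : Z * Z) := (lat i.1, lat i.2).
have iota_inj : injective iota.
  by move=> [x y] [x' y'] [/lattice_pt_inj /= -> /lattice_pt_inj /= ->].
have iotaE i : [set iota i] = [set lat i.1] `*` [set lat i.2].
  by apply/seteqP; split => [u -> //|[u v] [/= -> ->]].
have iota_meas i : measurable [set iota i].
  by rewrite iotaE; apply: measurableX; exact: measurable_point.
have mA := measurable_add_preimage (measurable_point (lat z)).
rewrite (@measure_countable_image _ _ _ (m1 \x m2)%E _ _ iota_inj iota_meas)//; last first.
  apply: product_measure_offlattice => //.
    by apply: measurableC; exact: measurable_countable_range.
  apply/seteqP; split => // -[u v] [/= nr [[x _ xu] [y _ yv]]]; apply: nr.
  by exists (x, y); rewrite /iota //= xu yv.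
rewrite (_ : [set i | _] = (fun x => (x, z - x)) @` [set: Z]); last first.
  apply/seteqP; split => [[x y] /=|_ [x _ <-]] /=; rewrite -lattice_ptD.
    by move=> /lattice_pt_inj <-; exists x => //; rewrite addrC addKr.
  by rewrite addrC subrK.
rewrite esum_image; last by move=> x y _ _ [].
rewrite [RHS](_ : _ =
  (tsum (fun x => finite_measure_l1 m1 x * finite_measure_l1 m2 (z - x)))%:E)//.
rewrite tsum_nneg; last 2 first.
- by move=> x; rewrite mulr_ge0//= fine_ge0.
- exact: absum_convolution.
apply: eq_esum => x _; rewrite iotaE.
transitivity (m1 [set lat x] * m2 [set lat (z - x)])%E.
  by apply: product_measure1E; exact: measurable_point.
by rewrite EFinM /= !fineK//; apply: fin_num_measure; exact: measurable_point.
Qed.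

Lemma convolution_l1 (M M' : smeasure) : lattice_charge M -> lattice_charge M' ->
  charge_l1 (convolution M M' : smeasure) = charge_l1 M * charge_l1 M'.
Proof.
move=> LM LM'; apply: l1_ext => z.
have hp := pos_part_lattice LM; have hn := neg_part_lattice LM.
have hp' := pos_part_lattice LM'; have hn' := neg_part_lattice LM'.
apply: EFin_inj; rewrite -charge_l1E [LHS]/=.
have -> : (convolution M M' [set lat z] =
    (((finite_measure_l1 (pos_part M) * finite_measure_l1 (pos_part M') +
       finite_measure_l1 (neg_part M) * finite_measure_l1 (neg_part M')) -
      (finite_measure_l1 (pos_part M) * finite_measure_l1 (neg_part M') +
       finite_measure_l1 (neg_part M) * finite_measure_l1 (pos_part M'))) z)%R%:E)%E.
  by rewrite /convolution /Defs.add_preim !product_measure_add// -!EFinD -EFinN -EFinD.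
by rewrite !charge_l1_parts; congr (l1_fun _ z)%:E; ring.
Qed.

Lemma lattice_convolution (M M' : smeasure) : lattice_charge M -> lattice_charge M' ->
  lattice_charge (convolution M M' : smeasure).
Proof.
move=> LM LM' A mA A0.
have B0 : (fun z : V * V => z.1 + z.2) @^-1` A `&` (lattice `*` lattice) = set0.
  apply/seteqP; split => // -[u v] [/= Auv [[x _ xu] [y _ yv]]].
  rewrite -[False]/(set0 (u + v)) -A0; split => //.
  by exists (x + y) => //; rewrite lattice_ptD xu yv.
have mB := measurable_add_preimage mA.
have hp := pos_part_lattice LM; have hn := neg_part_lattice LM.
have hp' := pos_part_lattice LM'; have hn' := neg_part_lattice LM'.
by rewrite /= /convolution /Defs.add_preim !product_measure_offlattice// !adde0 oppe0 ?adde0.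
Qed.

Lemma lattice_unit_mass : lattice_charge (unit_mass R d).
Proof.
move=> A mA A0; rewrite /unit_mass /= /charge_of_finite_measure diracE.
rewrite (_ : _ \in A = false)//; apply/negbTE; rewrite notin_setE => Ax.
by rewrite -[False]/(set0 (0 : V)) -A0; split => //; exists 0 => //; exact: lattice_pt0.
Qed.

Lemma unit_mass_l1 : charge_l1 (unit_mass R d) = 1.
Proof.
apply: l1_ext => z; rewrite [LHS](_ : _ = fine (\d_(0 : V) [set lat z]))// diracE l1_oneE /=.
congr (_%:R); congr nat_of_bool; apply/idP/eqP => [|->].
  by rewrite inE /= -lattice_pt0 => /lattice_pt_inj.
by rewrite inE /= lattice_pt0.
Qed.

Lemma lattice_convpow (M : smeasure) j : lattice_charge M -> lattice_charge (convpow M j).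
Proof.
move=> LM; elim: j => [|j IH]; first exact: lattice_unit_mass.
exact: lattice_convolution.
Qed.

Lemma convpow_l1 (M : smeasure) j : lattice_charge M ->
  charge_l1 (convpow M j) = charge_l1 M ^+ j.
Proof.
move=> LM; elim: j => [|j IH]; first exact: unit_mass_l1.
by rewrite exprS -IH -convolution_l1//; exact: lattice_convpow.
Qed.

Lemma cadd_l1 (M M' : smeasure) :
  charge_l1 (cadd M M' : smeasure) = charge_l1 M + charge_l1 M'.
Proof.
apply: l1_ext => z; rewrite /= /cadd /= fineD//;
  apply: fin_num_measure; exact: measurable_point.
Qed.

Lemma copp_l1 (M : smeasure) : charge_l1 (copp M : smeasure) = - charge_l1 M.
Proof. by apply: l1_ext => z; rewrite /= /copp /= fineN. Qed.

Lemma cscale_l1 (c : R) (M : smeasure) : charge_l1 (cscale c M : smeasure) = c *: charge_l1 M.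
Proof.
apply: l1_ext => z; rewrite /= /cscale /= fineM//;
  apply: fin_num_measure; exact: measurable_point.
Qed.

Lemma lattice_cadd (M M' : smeasure) : lattice_charge M -> lattice_charge M' ->
  lattice_charge (cadd M M' : smeasure).
Proof. by move=> LM LM' A mA A0; rewrite [LHS](_ : _ = M A + M' A)%E// LM// LM'// adde0. Qed.

Lemma lattice_copp (M : smeasure) : lattice_charge M -> lattice_charge (copp M : smeasure).
Proof. by move=> LM A mA A0; rewrite [LHS](_ : _ = - M A)%E// LM// oppe0. Qed.

Lemma lattice_cscale (c : R) (M : smeasure) :
  lattice_charge M -> lattice_charge (cscale c M : smeasure).
Proof. by move=> LM A mA A0; rewrite [LHS](_ : _ = c%:E * M A)%E// LM// mule0. Qed.

Lemma lattice_cexp (M : smeasure) : lattice_charge M -> lattice_charge (cexp M : smeasure).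
Proof.
move=> LM A mA A0; rewrite /cexp; apply: (@eseries0 _ _ 0 xpredT) => j _ _.
by rewrite lattice_convpow// mule0.
Qed.

Lemma cvg_cexp_l1 (M : smeasure) z : lattice_charge M ->
  (fun n => exp_partial (charge_l1 M) n z) @ \oo --> charge_l1 (cexp M : smeasure) z.
Proof.
move=> LM.
have : EFin \o (fun n => exp_partial (charge_l1 M) n z) @ \oo -->
    (charge_l1 (cexp M : smeasure) z)%:E.
  rewrite -charge_l1E.
  rewrite (_ : EFin \o _ =
    fun n => (\sum_(0 <= j < n) (j`!%:R^-1)%:E * convpow M j [set lat z])%E).
    by apply: cvg_cexp; exact: measurable_point.
  apply/funext => n /=; rewrite /exp_partial l1_sumE big_mkord -sumEFin.
  by apply: eq_bigr => j _; rewrite l1_scaleE EFinM -convpow_l1// charge_l1E.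
by move=> /fine_cvgP[].
Qed.

End lattice_charges.

(** * The distribution and its expansion *)

Section l1_exponential.
Variables (R : realType) (T : zmodType).

(** Fatou for the counting measure: finite subsums pass to the limit, and the norm is their
    supremum. *)
Lemma l1_norm_le_pointwise (f : nat -> l1 R T) (g : l1 R T) (c : R) :
  (forall x, (fun n => f n x) @ \oo --> g x) ->
  (\forall n \near \oo, l1_norm (f n) <= c) -> l1_norm g <= c.
Proof.
move=> fg fc; rewrite -lee_fin -esum_l1_norm; apply: ge_ereal_sup => _ [X [finX _] <-].
rewrite fsbig_finite//= sumEFin lee_fin.
have cvgX : (fun n => \sum_(x <- finmap.enum_fset (fset_set X)) `|f n x|) @ \oo -->
    \sum_(x <- finmap.enum_fset (fset_set X)) `|g x|.
  apply: cvg_big => [|x _]; first exact: add_continuous.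
  by apply: cvg_norm; exact: fg.
have <- := cvg_lim (@Rhausdorff R) cvgX.
apply: limr_le; first by apply/cvg_ex; eexists; exact: cvgX.
near=> n; apply: (@le_trans _ _ (l1_norm (f n))); last by near: n.
rewrite -lee_fin -esum_l1_norm -sumEFin; apply: esum_ge.
by exists X => //; rewrite fsbig_finite.
Unshelve. all: by end_near. Qed.

(** [cexp] is defined setwise, hence gives pointwise limits only. The Fatou bound, applied to
    differences of partial sums, upgrades them to norm convergence at the rate of the tail of exp
    c. *)
Lemma l1_exp_cvg (f D : l1 R T) :
  (forall x, (fun n => exp_partial f n x) @ \oo --> D x) ->
  alg_cvg (l1_algnorm R T) (exp_partial f) D.
Proof.
move=> fD; set c := l1_norm f.
have c0 : 0 <= c by exact: (algnorm_ge0 (l1_algnorm R T)).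
pose s n := \sum_(j < n) j`!%:R^-1 * c ^+ j.
have sE : s = series (exp_coeff c).
  apply/funext => n; rewrite seriesEord /s; apply: eq_bigr => j _.
  by rewrite /exp_coeff mulrC.
apply: (@alg_cvg_le _ _ _ _ _ (fun n => expR c - s n)) => [m|]; last first.
  rewrite -(subrr (expR c)); apply: cvgB; first exact: cvg_cst.
  by rewrite sE; exact: is_cvg_series_exp_coeff.
apply: (@l1_norm_le_pointwise (fun n => exp_partial f m - exp_partial f n)) => [x|].
  by apply: cvgB; [exact: cvg_cst|exact: fD].
exists m => // n /= mn; rewrite -(subnKC mn).
have -> : exp_partial f m - exp_partial f (m + (n - m)) =
    - \sum_(j < n - m) (m + j)`!%:R^-1 *: f ^+ (m + j).
  by rewrite /exp_partial big_split_ord /= opprD addrA subrr sub0r.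
have h : s (m + (n - m))%N <= expR c by exact: exp_partial_sum_le.
rewrite [leLHS](algnormN (l1_algnorm R T)).
apply: le_trans (algnorm_sum (l1_algnorm R T) _ _ _) _.
apply: (@le_trans _ _ (s (m + (n - m))%N - s m)); last by rewrite lerD2r.
rewrite /s [X in _ <= X - _]big_split_ord /= [leRHS]addrC addKr; apply: ler_sum => j _.
rewrite [leLHS]l1_normZ ger0_norm ?invr_ge0// ler_wpM2l ?invr_ge0//.
exact: (algnorm_le_exp (N := l1_algnorm R T)).
Qed.

End l1_exponential.

(** * The given distribution and its support *)

Section lattice_distribution.
Variables (R : realType) (d : nat) (F : probability 'rV[R]_d R).
Local Notation V := 'rV[R]_d.
Local Notation Z := 'rV[int]_d.
Local Notation lat := (@lattice_pt R d).
Hypothesis suppF : supp F `<=` range lat.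

(** Each point outside the support lies in a null ball with rational centre and radius, and there
    are countably many such balls. *)
Lemma prob_supportC (A : set V) : measurable A -> A `&` supp F = set0 -> (F A = 0)%E.
Proof.
move=> mA A0.
pose I := ('M[rat]_(1, d) * rat)%type.
pose B (i : I) : set V := (ball (map_mx ratr i.1 : V) (ratr i.2 : R))°.
pose C n : set V := if pickle_inv n is Some i then
  if F (B i) == 0%E then B i else set0 else set0.
have mB i : measurable (B i) by apply: measurable_open_mx; exact: open_interior.
have AC : A `<=` \bigcup_n C n.
  move=> x Ax; have : ~ supp F x by move=> sx; rewrite -[False]/(set0 x) -A0.
  move=> /existsNP[U] /not_implyP[oU] /not_implyP[Ux] /negP; rewrite -leNgt => FU.
  move: (oU); rewrite openE => /(_ _ Ux); rewrite /interior -nbhs_ballE => -[e /= e0 eU].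
  have [q] : exists q : rat, ratr q \in `]0, (e / 2)[ by apply: rat_in_itvoo; lra.
  rewrite in_itv/= => /andP[q0 qe]; have [a ax] := rat_mx_approx x q0.
  have BU : B (a, q) `<=` U.
    move=> u /interior_subset au; apply: eU.
    apply: (@le_ball _ _ _ (ratr q + ratr q)); first by lra.
    exact: ball_triangle (ball_sym ax) au.
  have B0 : F (B (a, q)) = 0%E.
    apply/eqP; rewrite -measure_le0; apply: le_trans FU; apply: le_measure BU; rewrite inE//.
    exact: measurable_open_mx.
  exists (pickle (a, q)) => //; rewrite /C pickleK_inv B0 eqxx.
  rewrite /B (_ : (ball _ _)° = ball (map_mx ratr a : V) (ratr q))//.
  exact/interior_id/ball_open.
apply/negligibleP => //; apply: negligibleS AC _; apply: negligible_bigcup => n.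
rewrite /C; case: pickle_inv => [i|]; last exact: negligible_set0.
by case: eqP => [Bi|_]; [exact/negligibleP|exact: negligible_set0].
Qed.

Lemma lattice_distr : lattice_charge (charge_distr F).
Proof.
move=> A mA A0; apply: prob_supportC => //; apply/seteqP; split => // x [Ax sx].
by rewrite -A0; split => //; exact: suppF.
Qed.

Definition distr_l1 : l1 R Z := charge_l1 (charge_distr F).

Lemma distr_l1E z : distr_l1 z = mass F (lat z). Proof. by []. Qed.

Lemma distr_l1_ge0 z : 0 <= distr_l1 z. Proof. exact: fine_ge0. Qed.

Lemma distr_l1_total : l1_total distr_l1 = 1.
Proof.
apply: EFin_inj; rewrite tsum_nneg; [|exact: distr_l1_ge0|exact: l1P].
have Foff : F (~` range lat) = 0%E.
  apply: prob_supportC; first by apply: measurableC; exact: measurable_lattice.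
  by apply/seteqP; split => // x [nx /suppF].
have h : F setT = (\esum_(z in [set: Z]) F [set lat z])%E.
  exact: (measure_countable_image (@lattice_pt_inj R d)
    (fun z => measurable_point (lattice_pt R z)) measurableT Foff).
rewrite -[RHS](probability_setT F) h; apply: eq_esum => z _.
by rewrite -charge_l1E.
Qed.

Lemma delta_ge (y : R) (s : seq Z) : 0 < y -> uniq s -> 0 \notin s ->
  \sum_(z <- s) Num.min 1 (4 * y * distr_l1 z) <= delta F y.
Proof.
move=> y0 us s0.
have min0 (x : V) : (0 <= (Num.min 1 (4 * y * mass F x))%:E)%E.
  by rewrite lee_fin le_min ler01 mulr_ge0 ?mulr_ge0 ?(ltW y0)// fine_ge0.
(* Were this sum infinite, [fine] would make [delta] zero. It is at most 4 y times the mass of the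
   lattice. *)
have fin : (\esum_(x in supp F `\ 0%R) (Num.min 1 (4 * y * mass F x))%:E)%E \is a fin_num.
  rewrite ge0_fin_numE; last exact: esum_ge0.
  apply: (@le_lt_trans _ _ (\esum_(x in range lat) (4 * y * mass F x)%:E)%E).
    rewrite esum_mkcond [leRHS]esum_mkcond; apply: le_esum => x _.
    case: ifPn => [/set_mem[/suppF Lx _]|_].
      by rewrite mem_set// lee_fin ge_min lexx orbT.
    by case: ifP => // _; rewrite lee_fin !mulr_ge0 ?(ltW y0)// fine_ge0.
  rewrite esum_image; last by move=> ? ? _ _ /lattice_pt_inj.
  have := absum_nneg_fin (f := fun z => 4 * y * distr_l1 z) _ (absumZ (4 * y) (l1P distr_l1)).
  rewrite fin_numElt => /(_ _)/andP[]//.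
  by move=> z; rewrite !mulr_ge0 ?(ltW y0)// distr_l1_ge0.
rewrite /delta -lee_fin fineK// -sumEFin.
(* A point of mass 0 need not belong to the support; it contributes min(1, 0) = 0 and is dropped. *)
pose s' := [seq z <- s | 0 < distr_l1 z].
have -> : (\sum_(z <- s) (Num.min 1 (4 * y * distr_l1 z))%:E =
    \sum_(z <- s') (Num.min 1 (4 * y * distr_l1 z))%:E)%E.
  rewrite big_filter [RHS]big_mkcond; apply: eq_bigr => z _.
  case: ltP => // z0; have -> : distr_l1 z = 0.
    by apply/eqP; rewrite eq_le z0 distr_l1_ge0.
  by rewrite mulr0 minEle ler10.
have us' : uniq (map lat s').
  by rewrite (map_inj_uniq (@lattice_pt_inj R d)) filter_uniq.
apply: esum_ge; exists [set` map lat s'].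
  split; first exact: finite_seq.
  move=> _ /mapP[z zs ->]; move: zs; rewrite mem_filter => /andP[Fz zs]; split.
    move=> U oU Uz; apply: (@lt_le_trans _ _ (F [set lat z])).
      rewrite lt_neqAle measure_ge0 andbT; apply/eqP => h.
      by move: Fz; rewrite distr_l1E /mass -h ltxx.
    apply: le_measure; rewrite ?inE; first exact: measurable_point.
      exact: measurable_open_mx.
    by move=> _ ->.
  rewrite /= -lattice_pt0 => /lattice_pt_inj z0.
  by move: s0; rewrite -z0 zs.
by rewrite -fsbig_seq// big_map.
Qed.

Definition approxD_l1 : l1 R Z := charge_l1 (approxD F).

Lemma lattice_centered : lattice_charge (centered F).
Proof.
apply: lattice_cadd; first exact: lattice_distr.
by apply: lattice_copp; exact: lattice_unit_mass.
Qed.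

Lemma centered_l1 : charge_l1 (centered F) = distr_l1 - 1.
Proof. by rewrite /centered cadd_l1 copp_l1 unit_mass_l1. Qed.

Lemma lattice_approxD : lattice_charge (approxD F).
Proof.
apply/lattice_cexp/lattice_cadd; first exact: lattice_centered.
by apply/lattice_cscale/lattice_convpow; exact: lattice_centered.
Qed.

Lemma approxD_l1_cvg : alg_cvg (l1_algnorm R Z)
  (exp_partial ((distr_l1 - 1) - 2^-1 *: (distr_l1 - 1) ^+ 2)) approxD_l1.
Proof.
apply: l1_exp_cvg => z; rewrite -centered_l1 -scaleNr -convpow_l1; last exact: lattice_centered.
rewrite -cscale_l1 -cadd_l1; apply: cvg_cexp_l1.
apply: lattice_cadd; first exact: lattice_centered.
by apply/lattice_cscale/lattice_convpow; exact: lattice_centered.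
Qed.

Lemma tv_norm_error n k : (tv_norm (error F n k) =
  (l1_norm (distr_l1 ^+ n - \sum_(m < k.+1)
    'C(n, m)%:R * (approxD_l1 ^+ (n - m) * (distr_l1 - approxD_l1) ^+ m)))%:E)%E.
Proof.
rewrite /tv_norm -esum_l1_norm; apply: eq_esum => z _.
have lF := lattice_distr; have lD := lattice_approxD.
have lFD : lattice_charge (cadd (charge_distr F) (copp (approxD F))).
  by apply: lattice_cadd => //; exact: lattice_copp.
suff -> : error F n k [set lat z] = ((distr_l1 ^+ n - \sum_(m < k.+1)
    'C(n, m)%:R * (approxD_l1 ^+ (n - m) * (distr_l1 - approxD_l1) ^+ m)) z)%:E by [].
rewrite /error l1_addE l1_oppE l1_sumE EFinB -sumEFin; congr (_ - _)%E.
  by rewrite (charge_l1E (convpow (charge_distr F) n)) convpow_l1.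
apply: eq_bigr => m _; rewrite mulr_natl -[(_ * _) *+ _]scaler_nat l1_scaleE EFinM.
congr (_ * _)%E.
rewrite -copp_l1 -cadd_l1 -!convpow_l1// -convolution_l1.
- by rewrite -charge_l1E.
- exact: lattice_convpow.
- exact: lattice_convpow.
Qed.

End lattice_distribution.

(** The n^(k + 1) counting the terms meets n^(-3 (k + 1)) from smoothing. The powers of 1 / q are 3
    (k + 1) from smoothing and one from the bounded factor; as q < 1 and 3 k + 4 <= 6 k + 11 / 2,
    the exponent may be raised. *)
Lemma expansion_rate_le (R : realType) (k n : nat) (q Delta a kappa : R) :
  0 < q < 1 -> (0 < n)%N -> 0 <= Delta -> 0 <= a -> 0 <= kappa ->
  n%:R ^+ k.+1 * (a * (4 / q * (kappa * Delta / (n%:R * q)) ^+ (3 * k.+1))) <=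
  (a * 4 * kappa ^+ (3 * k.+1)) * Delta ^+ (3 * k.+1) /
    (q `^ (6 * k%:R + 11 / 2) * n%:R ^+ (2 * k.+1)).
Proof.
move=> /andP[q0 q1] n0 D0 a0 k0; have n0' : 0 < n%:R :> R by rewrite ltr0n.
have qle : q `^ (6 * k%:R + 11 / 2) <= q ^+ (3 * k.+1).+1.
  rewrite -powR_mulrn ?(ltW q0)//; apply: ger_powR; first by rewrite q0 ltW.
  have -> : (3 * k.+1).+1%:R = 3 * k%:R + 4 :> R by rewrite -addn1 natrD natrM -natr1; lra.
  by have : 0 <= k%:R :> R by []; lra.
have -> : n%:R ^+ k.+1 * (a * (4 / q * (kappa * Delta / (n%:R * q)) ^+ (3 * k.+1))) =
    (a * 4 * kappa ^+ (3 * k.+1)) * Delta ^+ (3 * k.+1) /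
    (q ^+ (3 * k.+1).+1 * n%:R ^+ (2 * k.+1)).
  have -> : (3 * k.+1 = k.+1 + 2 * k.+1)%N by lia.
  rewrite [q ^+ _.+1]exprS expr_div_n !exprMn !exprD.
  have q' m : q ^+ m != 0 by rewrite expf_neq0// gt_eqF.
  have n' m : n%:R ^+ m != 0 :> R by rewrite expf_neq0// gt_eqF.
  move: (q' k.+1) (q' (2 * k.+1)%N) (n' k.+1) (n' (2 * k.+1)%N).
  move: (n%:R ^+ k.+1) (n%:R ^+ (2 * k.+1)) (q ^+ k.+1) (q ^+ (2 * k.+1))
    => u v s t s0 t0 u0 v0.
  by field; rewrite s0 t0 u0 v0 gt_eqF.
apply: ler_wpM2l; first by rewrite !mulr_ge0 ?exprn_ge0.
have nk : 0 < n%:R ^+ (2 * k.+1) :> R by rewrite exprn_gt0.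
rewrite lef_pV2; first by rewrite ler_wpM2r// ltW.
- by rewrite posrE mulr_gt0// exprn_gt0.
- by rewrite posrE mulr_gt0// powR_gt0.
Qed.

Theorem theorem6 (R : realType) (k : nat) :
  exists2 C : R, 0 < C &
  forall (d : nat) (F : probability 'rV[R]_d R) (n : nat),
    (0 < d)%N ->
    symmetric_distr F ->
    supp F `<=` range (@lattice_pt R d) ->
    let q := mass F 0 in
    0 < q < 1 ->
    (k < n)%N ->
    (tv_norm (error F n k) <=
      (C * delta F (n%:R * q) ^+ (3 * k.+1)
         / (q `^ (6 * k%:R + 11 / 2) * n%:R ^+ (2 * k.+1))
       + C * (1 - q) ^+ (6 * k.+1)
         / (n%:R ^+ (2 * k.+1) * q `^ (6 * k%:R + 13 / 2)))%:E)%E.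
Proof.
pose kappa : R := (12 * k.+1 ^ 2)%:R.
have e0 : 0 < 1 + 8 * expR 4 :> R by rewrite addr_gt0// mulr_gt0// expR_gt0.
have kappa0 : 0 < kappa by rewrite ltr0n muln_gt0 expn_gt0.
(* The three factors come from the quotients [H] of F - D by w^3, from the bound 4 / q, and from the
   smoothing of the 3 (k + 1) factors w. *)
exists ((1 + 8 * expR 4) ^+ k.+1 * 4 * kappa ^+ (3 * k.+1)).
  by rewrite !mulr_gt0 ?exprn_gt0.
move=> d F n _ symF suppF q q01 kn.
have [q0 q1] := andP q01; have n0 : (0 < n)%N := leq_ltn_trans (leq0n k) kn.
have y0 : 0 < n%:R * q by rewrite mulr_gt0 ?ltr0n.
have qE : distr_l1 F 0 = q by rewrite distr_l1E lattice_pt0.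
have Fsym z : distr_l1 F (- z) = distr_l1 F z by rewrite !distr_l1E lattice_ptN -symF.
have tf2 (z : 'rV[int]_d) : z = - z -> z = 0.
  move=> /matrixP zN; apply/matrixP => i j; have := zN i j; rewrite !mxE => /eqP.
  by rewrite -addr_eq0 -mulr2n mulrn_eq0 => /eqP.
have Delta_ub s : uniq s -> 0 \notin s ->
    \sum_(z <- s) Num.min 1 (4 * (n%:R * q) * distr_l1 F z) <= delta F (n%:R * q).
  by move=> us s0; apply: delta_ge.
have Delta0 : 0 <= delta F (n%:R * q) by have := Delta_ub [::] isT isT; rewrite big_nil.
have Fatom : 0 < distr_l1 F 0 < 1 by rewrite qE.
have HF := symmetric_element_l1 (@distr_l1_ge0 R d F) (distr_l1_total suppF) Fsym Fatom tf2
  Delta_ub.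
rewrite -qE in HF.
rewrite tv_norm_error// lee_fin.
apply: le_trans (expansion_remainder_le kn HF (approxD_l1_cvg suppF)) _.
rewrite qE; apply: le_trans (@expansion_rate_le _ _ _ _ _ _ _ q01 n0 Delta0
  (exprn_ge0 k.+1 (ltW e0)) (ltW kappa0)) _.
rewrite lerDl divr_ge0 ?mulr_ge0 ?exprn_ge0 ?powR_ge0//; last by rewrite subr_ge0 ltW.
all: exact: ltW.
Qed.
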